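(* Let $A,B\subset\Omega$ be disjoint measurable sets, and let $\mathcal{U}_{AB}^K$ be the set of unit flows $\Phi$ from $A$ to $B$ that are absolutely continuous with respect to $K$ and finite (i.e. $\Phi(\Omega\times\Omega)<\infty$). Then $$\mathrm{cap}(A,B)=\sup_{\Phi\in\mathcal{U}_{AB}^K}\mathbb{E}^\Phi\left[\left(\sum_{n=1}^{\tau_B^Y}\frac{\mathrm{d}\Phi}{\mathrm{d}K}(Y_{n-1},Y_n)\right)^{-1}\right].$$ The identity remains true when the supremum is restricted to the smaller set of loop-free unit flows in $\mathcal{U}_{AB}^K$.
   Context: Setting. $\Omega$ is a Polish space with Borel $\sigma$-algebra $\mathcal{F}$. $k(x,\mathrm{d}y)$ is a kernel on $\Omega$ with $k(x,\Omega)<\infty$ for all $x$. $\mu$ is a $\sigma$-finite measure with $\mu(\mathrm{d}x)k(x,\mathrm{d}y)=\mu(\mathrm{d}y)k(y,\mathrm{d}x)$. Put $K(\mathrm{d}x,\mathrm{d}y)=\mu(\mathrm{d}x)k(x,\mathrm{d}y)$, a symmetric measure on $\Omega\times\Omega$. It is assumed that $K(\Omega\times\Omega)<\infty$ and that $k(x,\Omega)>0$ for $\mu$-a.a. $x$. $X=(X_t)_{t\ge0}$ is the continuous-time (minimal) Markov jump process with jump rates $k(x,\mathrm{d}y)$; $\mathbb{P}_x$ is its law given $X_0=x$, and $\tau_C=\inf\{t>0: X_t\in C\}$. $X$ is assumed irreducible and recurrent: for every measurable $C$ with $\mu(C)>0$, $\mathbb{P}_x(\tau_C<\infty)$ is positive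 (irreducibility) and in fact equal to $1$ (recurrence) for $\mu$-a.a. $x$. Generator. For bounded measurable $f$, $(Lf)(x)=\int_\Omega[f(y)-f(x)]\,k(x,\mathrm{d}y)$. Capacity. $h_{AB}(x)=1$ for $x\in A$, $h_{AB}(x)=0$ for $x\in B$, $h_{AB}(x)=\mathbb{P}_x(\tau_A<\tau_B)$ for $x\notin A\cup B$, and $\mathrm{cap}(A,B)=\int_A(-Lh_{AB})(x)\,\mu(\mathrm{d}x)$. Unit flow. A unit flow from $A$ to $B$ is a $\sigma$-finite measure $\Phi$ on $\Omega\times\Omega$ such that: (1) $\Phi(A\times\Omega)=1$ and $\Phi(\Omega\times A)=0$; (2) $\Phi(\Omega\times B)=1$ and $\Phi(B\times\Omega)=0$; (3) $\Phi(\Omega\times C)=\Phi(C\times\Omega)$ for all measurable $C\subset\Omega\setminus(A\cup B)$; (4) there is a measurable $\chi\subset\Omega\times\Omega$ with $\Phi(\chi^{\mathrm c})=0$ and $(y,x)\notin\chi$ for all $(x,y)\in\chi$. It is loop-free if $\chi$ in (4) can be chosen to contain no loops: whenever $(\gamma_0,\dots,\gamma_n)$ is a finite sequence with $\gamma_n=\gamma_0$ ($n\ge1$), then $(\gamma_{j-1},\gamma_j)\notin\chi$ for some $j\in\{1,\dots,n\}$. Associated Markov chain. For a unit flow $\Phi$ let $\nu(C)=\Phi(C\times\Omega)$ and let $\ell(x,\mathrm{d}y)$ be any probability kernel with $\Phi(\mathrm{d}x,\mathrm{d}y)=\nu(\mathrm{d}x)\ell(x,\mathrm{d}y)$. Under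 $\mathbb{P}^\Phi$ (expectation $\mathbb{E}^\Phi$), $Y=(Y_n)_{n\in\mathbb{N}_0}$ is the Markov chain with initial law $\mathbb{P}^\Phi(Y_0\in C)=\nu(A\cap C)$ and transition kernel $\ell$; $\tau_B^Y=\min\{n\in\mathbb{N}: Y_n\in B\}$ ($n\ge1$). (The law of $Y$ stopped at $\tau_B^Y$ does not depend on the choice of $\ell$, and for finite $\Phi$ one has $\tau_B^Y<\infty$ a.s.) Convention: suprema are taken in $[0,\infty]$ (so the supremum of the empty set is $0$). *)

(* Defs.v *)
From HB Require Import structures.
From mathcomp Require Import all_boot all_order all_algebra.
From mathcomp Require Import all_classical all_reals all_analysis.
From mathcomp Require Import measurable_realfun.

Set Implicit Arguments.
Unset Strict Implicit.
Unset Printing Implicit Defensive.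
Import Order.TTheory GRing.Theory Num.Theory.
Import numFieldNormedType.Exports.

Local Open Scope classical_set_scope.
Local Open Scope ring_scope.
Local Open Scope ereal_scope.

(* A complete pseudometric space is Polish when it is moreover Hausdorff (so
   that the pseudometric is a metric) and separable. *)
Definition polish (R : realType) (T : completePseudoMetricType R) : Prop :=
  hausdorff_space T /\ exists D : set T, countable D /\ dense D.

Notation borel T := (g_sigma_algebraType (@open T)).

Section jump_process.
Context (R : realType) (d : measure_display) (T : measurableType d).
Implicit Types (mu : {measure set T -> \bar R}) (k : R.-ker T ~> T).

Definition edge_measure mu k (K : set (T * T)%type -> \bar R) : Prop :=
  forall E, measurable E -> K E = \int[mu]_x k x (xsection E x).

(* mu(dx) k(x,dy) = mu(dy) k(y,dx) as measures on T * T *)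
Definition reversible mu k : Prop :=
  forall E : set (T * T), measurable E ->
    \int[mu]_x k x (xsection E x) = \int[mu]_y k y (ysection E y).

Definition jump_rate k (x : T) : R := fine (k x setT).

(* Law of the next state; a state with total rate 0 is absorbing. *)
Definition jump_law k (x : T) (C : set T) : \bar R :=
  if k x setT == 0 then \d_x C else k x C / k x setT.

Context (dW : measure_display) (W : measurableType dW).
Implicit Types (Z : nat -> W -> T) (S : nat -> W -> \bar R).

(* sigma(Z_0, S_0, ..., Z_(n-1), S_(n-1), Z_n) *)
Definition jump_history Z S (n : nat) : set (set W) :=
  <<s [set E | (exists2 i, (i <= n)%N &
                  exists2 C, measurable C & E = Z i @^-1` C) \/
               (exists2 i, (i < n)%N &
                  exists2 C : set (\bar R), measurable C & E = S i @^-1` C)] >>.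

(* Jump-and-hold description: Z_n is the n-th visited state and S_n its holding
   time (+oo once an absorbing state is reached).  Under P x the chain starts
   from x and, given the history up to the arrival in Z_n, the holding time S_n
   is exponential with parameter k(Z_n, T) and independent of Z_(n+1), whose law
   is k(Z_n, dy) / k(Z_n, T). *)
Record jump_and_hold k (P : R.-pker T ~> W) Z S : Prop := {
  jah_measurable_state : forall n, measurable_fun setT (Z n) ;
  jah_measurable_hold : forall n, measurable_fun setT (S n) ;
  jah_hold_ge0 : forall n w, 0 <= S n w ;
  jah_start : forall x C, measurable C -> P x (Z 0%N @^-1` C) = \d_x C ;
  jah_step : forall x n E t C, jump_history Z S n E -> (0 <= t)%R ->
    measurable C ->
    P x (E `&` [set w | t%:E < S n w] `&` (Z n.+1 @^-1` C)) =
    \int[P x]_(w in E)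
      ((expR (- (jump_rate k (Z n w) * t)))%:E * jump_law k (Z n w) C) }.

Definition jump_time S (n : nat) (w : W) : \bar R := \sum_(i < n) S i w.

(* State of the minimal process at time t: Z_n on [T_n, T_(n+1)), and the
   cemetery None from the explosion time on. *)
Definition minimal_process Z S (t : R) (w : W) : option T :=
  match pselect (exists n, jump_time S n w <= t%:E < jump_time S n.+1 w) with
  | left e => Some (Z (projT1 (cid e)) w)
  | right _ => None
  end.

Implicit Type X : R -> W -> option T.

Definition hitting_time X (C : set T) (w : W) : \bar R :=
  ereal_inf [set t%:E | t in
    [set t : R | (0 < t)%R /\ exists2 x, C x & X t w = Some x]].

Definition irreducible mu (P : R.-pker T ~> W) X : Prop :=
  forall C, measurable C -> 0 < mu C ->
    {ae mu, forall x, 0 < P x [set w | hitting_time X C w < +oo]}.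

Definition recurrent mu (P : R.-pker T ~> W) X : Prop :=
  forall C, measurable C -> 0 < mu C ->
    {ae mu, forall x, P x [set w | hitting_time X C w < +oo] = 1}.

Definition generator k (f : T -> R) (x : T) : \bar R :=
  \int[k x]_y (f y - f x)%:E.

Definition harmonic (P : R.-pker T ~> W) X (A B : set T) (x : T) : R :=
  if x \in A then 1%R else if x \in B then 0%R else
  fine (P x [set w | hitting_time X A w < hitting_time X B w]).

Definition capacity mu k (P : R.-pker T ~> W) X (A B : set T) : \bar R :=
  \int[mu]_(x in A) (- generator k (harmonic P X A B) x).

End jump_process.

Section unit_flow.
Context (R : realType) (d : measure_display) (T : measurableType d).
Implicit Types (Phi : {measure set (T * T)%type -> \bar R}) (chi : set (T * T)).

Definition flow_support Phi chi : Prop :=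
  [/\ measurable chi, Phi (~` chi) = 0 &
      forall x y, chi (x, y) -> ~ chi (y, x)].

Definition no_loops chi : Prop :=
  forall (n : nat) (g : nat -> T), (0 < n)%N -> g n = g 0%N ->
    exists2 j, (1 <= j <= n)%N & ~ chi (g j.-1, g j).

Record unit_flow (A B : set T) Phi : Prop := {
  uf_sigma_finite : sigma_finite setT Phi ;
  uf_source : Phi (A `*` setT) = 1 /\ Phi (setT `*` A) = 0 ;
  uf_sink : Phi (setT `*` B) = 1 /\ Phi (B `*` setT) = 0 ;
  uf_kirchhoff : forall C, measurable C -> C `<=` ~` (A `|` B) ->
    Phi (setT `*` C) = Phi (C `*` setT) ;
  uf_support : exists chi, flow_support Phi chi }.

Definition loop_free_unit_flow (A B : set T) Phi : Prop :=
  unit_flow A B Phi /\ exists2 chi, flow_support Phi chi & no_loops chi.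

Definition ac_flows (A B : set T) (K : {finite_measure set (T * T)%type -> \bar R}) :
    set {finite_measure set (T * T)%type -> \bar R} :=
  [set Phi | unit_flow A B Phi /\ Phi `<< K].

Definition ac_loop_free_flows (A B : set T)
    (K : {finite_measure set (T * T)%type -> \bar R}) :
    set {finite_measure set (T * T)%type -> \bar R} :=
  [set Phi | loop_free_unit_flow A B Phi /\ Phi `<< K].

Definition out_flow Phi (C : set T) : \bar R := Phi (C `*` setT).

Context (dW : measure_display) (W : measurableType dW).
Implicit Types (Q : probability W R) (Y : nat -> W -> T).

(* sigma(Y_0, ..., Y_n) *)
Definition chain_history Y (n : nat) : set (set W) :=
  <<s [set E | exists2 i, (i <= n)%N &
                 exists2 C, measurable C & E = Y i @^-1` C] >>.

Record markov_chain Q Y (init : set T -> \bar R) (l : R.-pker T ~> T) : Prop := {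
  mc_measurable : forall n, measurable_fun setT (Y n) ;
  mc_start : forall C, measurable C -> Q (Y 0%N @^-1` C) = init C ;
  mc_step : forall n E C, chain_history Y n E -> measurable C ->
    Q (E `&` (Y n.+1 @^-1` C)) = \int[Q]_(w in E) l (Y n w) C }.

Definition flow_chain (A : set T) Phi Q Y : Prop :=
  exists l : R.-pker T ~> T,
    (forall E, measurable E ->
       Phi E = \int[out_flow Phi]_x l x (xsection E x)) /\
    markov_chain Q Y (fun C => out_flow Phi (A `&` C)) l.

(* min {n >= 1 | Y_n \in B}, equal to +oo if there is no such n *)
Definition chain_hitting_time Y (B : set T) (w : W) : \bar R :=
  ereal_inf [set n%:R%:E | n in [set n | (0 < n)%N /\ B (Y n w)]].

Local Open Scope charge_scope.

Definition flow_density (Phi K : {finite_measure set (T * T)%type -> \bar R}) :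
    T * T -> \bar R :=
  'd (charge_of_finite_measure Phi) '/d K.

Definition flow_value (Phi K : {finite_measure set (T * T)%type -> \bar R})
    Q Y (B : set T) : \bar R :=
  \int[Q]_w
    (\sum_(1 <= n <oo | n%:R%:E <= chain_hitting_time Y B w)
       flow_density Phi K (Y n.-1 w, Y n w))^-1.

End unit_flow.

(* Supremum in [0, +oo], for which the empty set has supremum 0. *)
Definition sup_ge0 (R : realType) (V : set (\bar R)) : \bar R :=
  ereal_sup (0 |` V).

(* Main.v *)
Require Import Defs.
From HB Require Import structures.
From mathcomp Require Import all_boot all_order all_algebra.
From mathcomp Require Import all_classical all_reals all_analysis.
From mathcomp Require Import measurable_realfun ring lra.

Set Implicit Arguments.
Unset Strict Implicit.
Unset Printing Implicit Defensive.
Import Order.TTheory GRing.Theory Num.Theory.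
Import numFieldNormedType.Exports.

Local Open Scope classical_set_scope.
Local Open Scope ring_scope.
Local Open Scope ereal_scope.

(** Write K for the symmetric finite measure of edges and h for the probability
    of entering A before B, with h = 1 on A and h = 0 on B.  Two properties of
    h, harmonicity and the Dirichlet identity, give the variational principle.

    The function h is harmonic off A and B: for the process started at x, h(x) is
    the sum over n of the probability that the embedded jump chain enters A at
    step n without having met A or B before, and these probabilities satisfy a
    one-step recursion (hit_prob_harmonic).  The passage from the jump process
    in continuous time to its jump chain is exact up to a null event: almost
    surely all holding times are positive, and a holding time is infinite only
    in an absorbing state, from which A is no longer reached
    (hitting_before_first_hit).

    Harmonicity and the symmetry of K give the Dirichlet identity: cap(A,B) is
    half the integral of (h(x) - h(y))^2 against K.  A set of edges that contains
    no edge together with its reverse carries at most half of that energy, hence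
    at most cap(A,B) (antisymmetric_energy_le).

    Upper bound.  Let Phi be a finite unit flow with density f with respect to K,
    carried by an antisymmetric set chi.  Along the chain Y of Phi the increments
    h(Y_(n-1)) - h(Y_n) up to the entrance in B sum to 1, so by Cauchy-Schwarz
    the inverse of the sum of the f(Y_(n-1), Y_n) is at most the sum of the
    (h(Y_(n-1)) - h(Y_n))^2 / f(Y_(n-1), Y_n).  Kirchhoff's law bounds the
    expected number of passages of Y through a set of edges by its Phi-mass
    (sum_step_law_le); in particular Y enters B almost surely.  Hence the expected
    value of the last sum is at most the integral of (h(x) - h(y))^2 / f against
    Phi = f K, that is, the energy of h on chi (flow_value_le_energy).

    Equality.  When cap(A,B) > 0, the measure with density
    max(h(x) - h(y), 0) / cap(A,B) is a unit flow, again by harmonicity and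
    symmetry.  The potential h decreases strictly along its edges, so it has no
    loops, and along its chain the densities telescope to 1 / cap(A,B)
    (flow_value_gradient).  The supremum is thus attained by a loop-free flow;
    when cap(A,B) = 0 the upper bound leaves only the value 0. *)

(** * Mixtures of measures and disintegration *)

Section mixture.
Context d d' (X : measurableType d) (S : measurableType d') (R : realType).
Variables (m : {measure set X -> \bar R}) (D : set X).
Hypothesis mD : measurable D.
Implicit Types (N : X -> {measure set S -> \bar R}).

(** With N x a Dirac mass this covers image measures, with N x a multiple of a
    Dirac mass the measures with a density, and with N x the law of the pair
    (x, y), y of law k x, the product of a measure and a kernel. *)
Lemma mixture_exists N :
    (forall U, measurable U -> measurable_fun [set: X] (N ^~ U)) ->
  exists M : {measure set S -> \bar R},
    forall U, M U = \int[m]_(x in D) N x U.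
Proof.
move=> mN; pose M U := \int[m]_(x in D) N x U.
have M0 : M set0 = 0.
  by rewrite /M integral0_eq// => x _; rewrite measure0.
have Mge0 U : 0 <= M U by apply: integral_ge0.
have Msigma : semi_sigma_additive M.
  move=> F mF tF mUF; rewrite [X in _ --> X](_ : _ =
    \int[m]_(x in D) (\sum_(n <oo) N x (F n))); last first.
    apply: eq_integral => x _.
    by apply/esym/cvg_lim => //; exact/measure_semi_sigma_additive.
  apply/cvg_closeP; split.
    by apply: is_cvg_nneseries => n _ _; exact: integral_ge0.
  rewrite closeE// integral_nneseries// => n.
  exact/measurable_funTS/mN.
pose mM := isMeasure.Build _ _ _ M M0 Mge0 Msigma.
by exists (HB.pack_for {measure set S -> \bar R} M mM).
Qed.

Import HBNNSimple.

(** Both sides are linear in g and commute with increasing limits, so that it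
    suffices to compare them on simple functions. *)
Lemma integral_mixture N (M : {measure set S -> \bar R}) (g : S -> \bar R) :
    (forall U, measurable U -> measurable_fun [set: X] (N ^~ U)) ->
    (forall U, measurable U -> M U = \int[m]_(x in D) N x U) ->
    measurable_fun [set: S] g -> (forall s, 0 <= g s) ->
  \int[M]_s g s = \int[m]_(x in D) \int[N x]_s g s.
Proof.
move=> mN MN mg g0.
have nnsfunE (f : {nnsfun S >-> R}) :
    \int[M]_s (f s)%:E = \int[m]_(x in D) \int[N x]_s (f s)%:E.
  rewrite integralT_nnsfun sintegralE.
  under [RHS]eq_integral do rewrite integralT_nnsfun sintegralE.
  rewrite ge0_integral_fsum//; last 2 first.
  - by move=> r; apply/measurable_funeM/measurable_funTS/mN.
  - by move=> r x _; exact: nnsfun_mulemu_ge0.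
  apply: eq_fsbigr => _ /set_mem [s _ <-]; rewrite MN// ge0_integralZl ?lee_fin//.
  exact/measurable_funTS/mN.
pose f_ := nnsfun_approx measurableT mg.
have limE (n : {measure set S -> \bar R}) :
    \int[n]_s g s = limn (fun i => \int[n]_s (f_ i s)%:E).
  rewrite -monotone_convergence//.
  - by apply: eq_integral => z _; apply/esym/cvg_lim => //=; exact: cvg_nnsfun_approx.
  - by move=> i; exact/measurable_EFinP.
  - by move=> i z _; rewrite lee_fin.
  - by move=> z _ a b ab; rewrite lee_fin; exact/lefP/nd_nnsfun_approx.
rewrite limE; under [RHS]eq_integral do rewrite limE.
rewrite monotone_convergence//; first by under eq_fun do rewrite nnsfunE.
- move=> n; apply: measurable_funTS; apply: measurable_fun_integral_kernel => //.
  + by move=> z; rewrite lee_fin.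
  + exact/measurable_EFinP.
- by move=> n y _; apply: integral_ge0 => // z _; rewrite lee_fin.
- move=> y _ a b ab; apply: ge0_le_integral => //.
  + by move=> z _; rewrite lee_fin.
  + exact/measurable_EFinP.
  + exact/measurable_EFinP.
  + by move=> z _; rewrite lee_fin; exact/lefP/nd_nnsfun_approx.
Qed.

End mixture.

(** A pushforward is a measure only when f is measurable, so the proof is an
    argument and the measure structure travels with it. *)
Definition image_measure d d' (X : measurableType d)
    (S : measurableType d') (R : realType) (m : {measure set X -> \bar R}) (f : X -> S)
    (mf : measurable_fun [set: X] f) : {measure set S -> \bar R} :=
  measure_function_pushforward__canonical__measure_function_Measure m mf.

(** The image of m restricted to D is the mixture over D of the Dirac masses at
    f w. *)
Lemma integral_image_restr d d' (X : measurableType d) (S : measurableType d')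
    (R : realType) (m : {measure set X -> \bar R}) (f : X -> S) D
    (M : {measure set S -> \bar R}) (g : S -> \bar R) :
    measurable_fun setT f -> measurable D ->
    (forall C, measurable C -> M C = m (D `&` f @^-1` C)) ->
    measurable_fun setT g -> (forall x, 0 <= g x) ->
  \int[M]_x g x = \int[m]_(w in D) g (f w).
Proof.
move=> mf mD ME mg g0.
rewrite (integral_mixture (m := m) (N := fun w => \d_(f w)) mD)//.
- by apply: eq_integral => w _; rewrite integral_dirac ?diracT ?mul1e.
- by move=> U mU; exact: (measurableT_comp (measurable_fun_dirac mU)).
- move=> U mU; rewrite ME//.
  transitivity (\int[m]_(w in D) (\1_(f @^-1` U) w)%:E); last exact: eq_integral.
  rewrite integral_indic//; last by rewrite -[X in measurable X]setTI; exact: mf.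
  by rewrite setIC.
Qed.

Section disintegration.
Context d d' (X : measurableType d) (S : measurableType d') (R : realType).

(** The sets E with this property form a lambda-system because each single
    measure k x is finite; the total masses may be unbounded in x, as jump rates
    are. *)
Lemma measurable_fun_xsection_kernel (k : R.-ker X ~> S) E :
    (forall x, k x setT < +oo) -> measurable E ->
  measurable_fun [set: X] (fun x => k x (xsection E x)).
Proof.
move=> kfin mE.
have kfinU x : exists r, forall U, measurable U -> mrestr (k x) measurableT U < r%:E.
  exists (fine (k x setT) + 1)%R => U mU; rewrite /mrestr /= setIT.
  rewrite (@le_lt_trans _ _ (k x setT))//; first by rewrite le_measure// inE.
  by rewrite EFinD fineK ?ge0_fin_numE// lteDl ?ge0_fin_numE.
have [_ mphi] := measurable_prod_subset_xsection_kernel kfinU mE.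
apply: eq_measurable_fun mphi => x _.
by rewrite /mrestr /= setIT.
Qed.

Lemma integral_disintegration (k : R.-ker X ~> S) (m : {measure set X -> \bar R})
    D (M : {measure set (X * S) -> \bar R}) (f : X * S -> \bar R) :
    (forall x, k x setT < +oo) -> measurable D ->
    (forall E, measurable E -> M E = \int[m]_(x in D) k x (xsection E x)) ->
    measurable_fun [set: X * S] f -> (forall z, 0 <= f z) ->
  \int[M]_z f z = \int[m]_(x in D) \int[k x]_y f (x, y).
Proof.
move=> kfin mD ME mf f0.
pose N x := image_measure (k x) (@pair1_measurable _ _ X S x).
have NE x E : N x E = k x (xsection E x) by rewrite xsectionE.
rewrite (integral_mixture (m := m) (N := N) mD)//.
- apply: eq_integral => x _.
  rewrite [LHS]ge0_integral_pushforward//; exact: pair1_measurable.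
- move=> E mE; under eq_fun do rewrite NE.
  exact: measurable_fun_xsection_kernel.
- by move=> E mE; rewrite ME//; apply: eq_integral => x _; rewrite NE.
Qed.

End disintegration.

Section markov_step.
Context dV (V : measurableType dV) d (T : measurableType d) (R : realType).
Variables (l : R.-pker T ~> T).
Variables (Y0 Y1 : V -> T) (E : set V).
Hypotheses (mY0 : measurable_fun setT Y0) (mY1 : measurable_fun setT Y1).
Hypothesis mE : measurable E.

Lemma markov_step_integral (Q : {measure set V -> \bar R}) (g : T -> \bar R) :
    (forall C, measurable C ->
      Q (E `&` Y1 @^-1` C) = \int[Q]_(w in E) l (Y0 w) C) ->
    measurable_fun setT g -> (forall x, 0 <= g x) ->
  \int[Q]_(w in E) g (Y1 w) = \int[Q]_(w in E) \int[l (Y0 w)]_y g y.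
Proof.
move=> step mg g0; pose M := image_measure (mrestr Q mE) mY1.
have ME C : measurable C -> M C = Q (E `&` Y1 @^-1` C) by move=> _; rewrite setIC.
rewrite -(integral_image_restr mY1 mE ME)//.
apply: (integral_mixture (N := fun w => l (Y0 w)) mE) => //.
- by move=> U mU; apply: (measurableT_comp (measurable_kernel l U mU)).
- by move=> U mU; rewrite ME// step.
Qed.

(** Both sides are finite measures in F that agree on rectangles. *)
Lemma markov_step_pair (Q : {finite_measure set V -> \bar R}) (F : set (T * T)) :
    (forall B C, measurable B -> measurable C ->
      Q (E `&` Y0 @^-1` B `&` Y1 @^-1` C) =
      \int[Q]_(w in E `&` Y0 @^-1` B) l (Y0 w) C) ->
    measurable F ->
  Q (E `&` [set w | F (Y0 w, Y1 w)]) =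
  \int[Q]_(w in E) l (Y0 w) (xsection F (Y0 w)).
Proof.
move=> step mF.
have lfin x : l x setT < +oo by rewrite prob_kernel ltry.
have mY01 : measurable_fun setT (fun w => (Y0 w, Y1 w)).
  exact: measurable_fun_pair.
pose M1 := image_measure (mrestr Q mE) mY01.
pose N w := image_measure (l (Y0 w)) (@pair1_measurable _ _ T T (Y0 w)).
have NE w G : N w G = l (Y0 w) (xsection G (Y0 w)) by rewrite xsectionE.
have mN G : measurable G -> measurable_fun setT (N ^~ G).
  move=> mG; under eq_fun do rewrite NE.
  exact: (measurableT_comp (measurable_fun_xsection_kernel lfin mG)).
have [M2 M2E] := mixture_exists Q mE mN.
suff M12 : M1 F = M2 F.
  rewrite -[LHS]/(Q (_ `&` _)) setIC -[LHS]/(M1 F) M12 M2E.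
  by apply: eq_integral => w _; rewrite NE.
(* rectangles form a pi-system that generates the product sigma-algebra *)
pose C : set (set (T * T)) :=
  [set A `*` B | A in measurable & B in measurable].
apply: (measure_unique C (fun=> setT)) => //.
- by rewrite measurable_prod_measurableType.
- move=> _ _ [X1 mX1 [X2 mX2 <-]] [Y1' mY1' [Y2 mY2 <-]].
  exists (X1 `&` Y1'); first exact: measurableI.
  by exists (X2 `&` Y2); [exact: measurableI|rewrite setXI].
- by move=> n; exists setT => //; exists setT => //; rewrite setXTT.
- by rewrite bigcup_const.
- move=> _ [A mA [B mB <-]].
  have mYA : measurable (Y0 @^-1` A).
    by rewrite -[X in measurable X]setTI; exact: mY0.
  rewrite M2E -[LHS]/(Q (_ `&` _)).
  transitivity (Q (E `&` Y0 @^-1` A `&` Y1 @^-1` B)).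
    by congr (Q _); apply/seteqP; split => [w [[? ?] ?]|w [[? ?] ?]].
  rewrite step// integral_mkcondr; apply: eq_integral => w _.
  rewrite NE patchE; case: ifPn => wA.
    by rewrite in_xsectionX//; move: wA; rewrite !inE.
  rewrite notin_xsectionX ?measure0//; move: wA; rewrite !notin_setE//.
- move=> _; rewrite -[X in X < _]/(Q (_ `&` _)).
  by rewrite ltey_eq fin_num_measure//; apply: measurableI => //; rewrite preimage_setT.
Qed.

End markov_step.

(** * Integrals of functions known off a null set *)

Section integral_off_null_set.
Context d (X : measurableType d) (R : realType) (m : {measure set X -> \bar R}).
Variables (N : set X) (f g : X -> \bar R).
Hypotheses (mN : measurable N) (N0 : m N = 0).
Hypotheses (mg : measurable_fun setT g) (g0 : forall x, 0 <= g x).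

Import HBNNSimple.

(** The two comparisons below allow f to be non-measurable, for the sake of
    the integrand of the value of a flow, which is a limit of sums of values
    of a density: off a null set the terms are nonnegative, on it the limit may
    fail to exist and its measurability is unclear. *)
Lemma integral_le_off_null : (forall x, ~ N x -> f x <= g x) ->
  \int[m]_x f x <= \int[m]_x g x.
Proof.
move=> fg; rewrite integralE.
apply: (@le_trans _ _ (\int[m]_x f^\+ x)); first by rewrite geeDl// leeNl oppe0 integral_ge0.
rewrite ge0_integralTE//; apply: ge_ereal_sup => _ [h hf <-].
rewrite -integralT_nnsfun; apply: ae_ge0_le_integral => //.
- by move=> x _; rewrite lee_fin.
- exact/measurable_EFinP.
- exists N; split => // x /= /not_implyP[_ hg]; apply: contrapT => Nx; apply: hg.
  apply: (le_trans (hf x)); by rewrite funeposE ge_max fg//= g0.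
Qed.

Lemma integral_ge_off_null : (forall x, ~ N x -> g x <= f x) ->
  \int[m]_x g x <= \int[m]_x f x.
Proof.
move=> gf; rewrite [leRHS]integralE.
have -> : \int[m]_x f^\- x = 0.
  apply/eqP; rewrite eq_le integral_ge0// andbT.
  rewrite ge0_integralTE//; apply: ge_ereal_sup => _ [h hf <-].
  rewrite -integralT_nnsfun -(integral0 m setT).
  apply: ae_ge0_le_integral => //.
  - by move=> x _; rewrite lee_fin.
  - exact/measurable_EFinP.
  - exists N; split => // x /= /not_implyP[_ hg]; apply: contrapT => Nx; apply: hg.
    apply: (le_trans (hf x)); rewrite funenegE ge_max lexx andbT.
    by rewrite leeNl oppe0 (le_trans (g0 x))// gf.
rewrite sube0 (ge0_negligible_integral mN)// setTD.
rewrite [leLHS]ge0_integralE// ge0_integralTE//; apply: le_ereal_sup.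
move=> _ [h hf <-]; exists h => // x; apply: (le_trans (hf x)).
rewrite patchE; case: ifPn => [/set_mem Nx|_]; last exact: funepos_ge0.
by apply: (le_trans (gf _ Nx)); rewrite funeposE le_max lexx.
Qed.

End integral_off_null_set.

(** * Passages of the chain of a flow *)

Section flow_chain_passages.
Context (R : realType) d (T : measurableType d) dV (V : measurableType dV).

(** Time 0 is left out because absorption is only counted from the first step
    on. *)
Definition alive (Y : nat -> V -> T) (B : set T) (n : nat) : set V :=
  [set w | forall m, (0 < m <= n)%N -> ~ B (Y m w)].

Lemma alive0 Y B : alive Y B 0 = setT.
Proof. by apply/seteqP; split => // w _ m; case: m. Qed.

Lemma aliveS Y B n : alive Y B n.+1 = alive Y B n `&` ~` (Y n.+1 @^-1` B).
Proof.
apply/seteqP; split => w /=.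
  move=> h; split; last by apply: h; rewrite /= leqnn.
  by move=> m /andP[m0 mn]; apply: h; rewrite m0 ltnW.
move=> [h1 h2] m /andP[m0]; rewrite leq_eqVlt => /orP[/eqP ->//|mn].
by apply: h1; rewrite m0 -ltnS.
Qed.

Lemma alive_le Y B n m : (m <= n)%N -> alive Y B n `<=` alive Y B m.
Proof.
by move=> mn w h i /andP[i0 im]; apply: h; rewrite i0 (leq_trans im).
Qed.

Lemma chain_history_measurable (Y : nat -> V -> T) n E :
    (forall m, measurable_fun setT (Y m)) ->
  chain_history Y n E -> measurable E.
Proof.
move=> mY; apply: smallest_sub; first exact: sigma_algebra_measurable.
move=> _ [i _ [C mC ->]]; rewrite -[X in measurable X]setTI; exact: mY.
Qed.

Lemma chain_historyS (Y : nat -> V -> T) n E :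
  chain_history Y n E -> chain_history Y n.+1 E.
Proof.
apply: sub_sigma_algebra2 => _ [i ni [C mC ->]].
by exists i; [exact: leqW|exists C].
Qed.

Lemma chain_history_preimage (Y : nat -> V -> T) n C : measurable C ->
  chain_history Y n (Y n @^-1` C).
Proof. by move=> mC; apply: sub_sigma_algebra; exists n => //; exists C. Qed.

Lemma chain_historyI (Y : nat -> V -> T) n E F :
  chain_history Y n E -> chain_history Y n F -> chain_history Y n (E `&` F).
Proof.
pose G := [set E | exists2 i, (i <= n)%N &
                 exists2 C, measurable C & E = Y i @^-1` C].
exact: (@measurableI _ (g_sigma_algebraType G)).
Qed.

Lemma alive_history Y B n : measurable B -> chain_history Y n (alive Y B n).
Proof.
move=> mB; elim: n => [|n ih].
  by rewrite alive0 -(preimage_setT (Y 0%N)); apply: chain_history_preimage.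
rewrite aliveS; apply: chain_historyI; first exact: chain_historyS.
exact: (chain_history_preimage (Y := Y) (n := n.+1) (measurableC mB)).
Qed.

Variables (A B : set T) (Phi : {finite_measure set (T * T)%type -> \bar R}).
Variables (Q : probability V R) (Y : nat -> V -> T).
Hypotheses (mA : measurable A) (mB : measurable B).
Hypotheses (flow : unit_flow A B Phi) (chain : flow_chain A Phi Q Y).

Local Notation surv := (alive Y B).

Lemma measurable_chain n : measurable_fun setT (Y n).
Proof. by have [l [_ [mY _ _]]] := chain; exact: mY. Qed.

Lemma measurable_alive n : measurable (surv n).
Proof.
apply: (@chain_history_measurable Y n); first exact: measurable_chain.
exact: alive_history.
Qed.

Lemma measurable_step n :
  measurable_fun setT (fun w => (Y n w, Y n.+1 w)).
Proof. by apply: measurable_fun_pair; exact: measurable_chain. Qed.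

Let occupation n := image_measure (mrestr Q (measurable_alive n)) (measurable_chain n).

Let occupationE n C : measurable C -> occupation n C = Q (surv n `&` Y n @^-1` C).
Proof. by move=> _; rewrite setIC. Qed.

Let out_flow_measure := image_measure Phi (@measurable_fst _ _ T T).

Let out_flowE : out_flow Phi = out_flow_measure.
Proof.
apply/funext => C; rewrite /out_flow /out_flow_measure /= /pushforward.
by congr (Phi _); apply/seteqP; split => [[x y] []|[x y]].
Qed.

(** A unit flow enters no point of A, and off A and B what flows in flows out.  So
    the mass that enters C off B, together with the mass injected in C at the
    source, is no more than the mass that leaves C. *)
Lemma in_flow_le_out_flow C : measurable C ->
  out_flow Phi (A `&` C) + Phi (setT `*` (C `\` B)) <= out_flow Phi C.
Proof.
move=> mC; have [_ [_ inA] [_ outB] kirchhoff _] := flow.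
have mCB : measurable (C `\` B) by exact: measurableD.
have mCBA : measurable (C `\` B `\` A) by exact: measurableD.
have -> : Phi (setT `*` (C `\` B)) = out_flow Phi (C `\` B `\` A).
  rewrite /out_flow -kirchhoff//; last by move=> x [[_ nB] nA] [].
  apply/eqP; rewrite eq_le; apply/andP; split; last first.
    by apply: le_measure; rewrite ?inE; [exact: measurableX..|
      move=> [x y] [_ [? _]]].
  apply: (@le_trans _ _ (Phi ((setT `*` (C `\` B `\` A)) `|` (setT `*` A)))).
    apply: le_measure; rewrite ?inE; [exact: measurableX| |].
      by apply: measurableU; exact: measurableX.
    move=> [x y] [_ CB]; have [Ay|nAy] := pselect (A y); first by right.
    by left.
  apply: (le_trans (measureU2 _ _ _)); [exact: measurableX..|].
  by rewrite [X in _ + X]inA adde0.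
rewrite out_flowE -measureU//; last 2 first.
- exact: measurableI.
- by apply/seteqP; split => // x [[Ax _] [_ /(_ Ax)]].
apply: le_measure; rewrite ?inE//.
  by apply: measurableU => //; exact: measurableI.
by move=> x [[]|[[]]].
Qed.

(** By induction on N: the occupation of C up to time N + 1 is the initial mass
    in C plus one step of the kernel applied to the occupation up to time N; that
    occupation is at most the out-flow, whose image under the kernel is the
    in-flow, and in_flow_le_out_flow closes the loop. *)
Lemma sum_occupation_le N C : measurable C ->
  \sum_(n < N) Q (surv n `&` Y n @^-1` C) <= out_flow Phi C.
Proof.
have [l [PhiE [mY start step]]] := chain.
elim: N C => [|N ih] C mC; first by rewrite big_ord0.
apply: le_trans (in_flow_le_out_flow mC).
rewrite big_ord_recl /= alive0 setTI start//; apply: leeD => //.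
have mCB : measurable (C `\` B) by exact: measurableD.
rewrite PhiE; last exact: measurableX.
have -> : \int[out_flow Phi]_x l x (xsection (setT `*` (C `\` B)) x) =
    \int[out_flow_measure]_x l x (C `\` B).
  rewrite out_flowE; apply: eq_integral => x _.
  by rewrite in_xsectionX// inE.
have sumE : \sum_(i < N) Q (surv (bump 0 i) `&` Y (bump 0 i) @^-1` C) =
    \int[msum occupation N]_x l x (C `\` B).
  rewrite ge0_integral_measure_sum//; last exact: measurable_kernel.
  apply: eq_bigr => i _; rewrite /bump leq0n add1n.
  rewrite (integral_image_restr (measurable_chain i) (measurable_alive i)
    (occupationE i))//; last exact: measurable_kernel.
  rewrite -step//; last exact: alive_history.
  rewrite aliveS; congr (Q _); apply/seteqP; split => w /=.
    by move=> [[? ?] ?].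
  by move=> [? [? ?]].
rewrite sumE; apply: ge0_le_measure_integral => //; last exact: measurable_kernel.
move=> U mU; rewrite -out_flowE; apply: le_trans (ih _ mU).
by rewrite /msum; apply: lee_sum => i _; rewrite -occupationE.
Qed.

Let step_law n := image_measure (mrestr Q (measurable_alive n)) (measurable_step n).

Let step_lawE n E : measurable E ->
  step_law n E = Q (surv n `&` [set w | E (Y n w, Y n.+1 w)]).
Proof. by move=> _; rewrite setIC. Qed.

(** The expected number of passages through E up to absorption is at most its
    mass under Phi: disintegrate both sides over the starting point of the edge
    and use sum_occupation_le. *)
Lemma sum_step_law_le N E : measurable E ->
  \sum_(n < N) Q (surv n `&` [set w | E (Y n w, Y n.+1 w)]) <= Phi E.
Proof.
have [l [PhiE [mY start step]]] := chain.
move=> mE; rewrite PhiE// out_flowE.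
have lfin x : l x setT < +oo by rewrite prob_kernel ltry.
have mlE := measurable_fun_xsection_kernel lfin mE.
apply: (@le_trans _ _ (\int[msum occupation N]_x l x (xsection E x))).
  rewrite ge0_integral_measure_sum//; apply: lee_sum => n _.
  rewrite (integral_image_restr (measurable_chain n) (measurable_alive n)
    (@occupationE n))//.
  rewrite (markov_step_pair (l := l))//; first exact: measurable_alive.
  move=> C C' mC mC'; apply: step => //; apply: chain_historyI.
    exact: alive_history.
  exact: chain_history_preimage.
apply: ge0_le_measure_integral => // C mC; rewrite -out_flowE.
apply: le_trans (sum_occupation_le N mC).
by rewrite /msum; apply: lee_sum => i _; rewrite -occupationE.
Qed.

Lemma expected_passages_le N (f : T * T -> \bar R) :
    measurable_fun setT f -> (forall z, 0 <= f z) ->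
  \sum_(n < N) \int[Q]_(w in surv n) f (Y n w, Y n.+1 w) <= \int[Phi]_z f z.
Proof.
move=> mf f0; apply: (@le_trans _ _ (\int[msum step_law N]_z f z)).
  rewrite ge0_integral_measure_sum//; apply: lee_sum => n _.
  by rewrite (integral_image_restr (measurable_step n) (measurable_alive n)
    (@step_lawE n)).
apply: ge0_le_measure_integral => // E mE.
apply: le_trans (sum_step_law_le N mE).
by rewrite /msum; apply: lee_sum => i _; rewrite -step_lawE.
Qed.

Lemma null_step n E : measurable E -> Phi E = 0 ->
  Q (surv n `&` [set w | E (Y n w, Y n.+1 w)]) = 0.
Proof.
move=> mE PhiE0; apply/eqP; rewrite eq_le measure_ge0 andbT -PhiE0.
apply: le_trans (sum_step_law_le n.+1 mE); rewrite big_ord_recr /=.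
by rewrite leeDr// sume_ge0.
Qed.

(** The expected absorption time is at most the total mass of Phi, which is
    finite. *)
Lemma never_absorbed_null : Q (\bigcap_n surv n) = 0.
Proof.
have mcap : measurable (\bigcap_n surv n).
  by apply: bigcapT_measurable => n; exact: measurable_alive.
set q := Q _; have qfin : q \is a fin_num by rewrite fin_num_measure.
have Phifin : Phi setT \is a fin_num by rewrite fin_num_measure.
(* each of the first N steps is made with probability at least q *)
have qN N : (N%:R * fine q <= fine (Phi setT))%R.
  rewrite -lee_fin EFinM !fineK//.
  apply: le_trans (sum_step_law_le N measurableT).
  rewrite -[N in N%:R]card_ord -sum1_card natr_sum -sumEFin.
  rewrite ge0_sume_distrl//; apply: lee_sum => n _; rewrite mul1e.
  apply: le_measure; rewrite ?inE//.
    apply: measurableI; first exact: measurable_alive.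
    by rewrite -[X in measurable X]setTI; exact: (@measurable_step n).
  by move=> w h; split => //; apply: h.
have q0 : (0 <= fine q)%R by apply: fine_ge0; exact: measure_ge0.
suff : (fine q <= 0)%R by move=> qle; apply/eqP; rewrite -fine_eq0// eq_le qle q0.
rewrite leNgt; apply/negP => qpos.
have := qN (Num.truncn (fine (Phi setT) / fine q)).+1.
rewrite -ler_pdivlMr// leNgt => /negP; apply.
exact: truncnS_gt.
Qed.

End flow_chain_passages.

(** * The value of a flow against a potential *)

Section path_functionals.
Context (R : realType) d (T : measurableType d) dV (V : measurableType dV).
Implicit Types (Y : nat -> V -> T) (B : set T).

Lemma le_chain_hitting_time Y B (n : nat) w :
  (n%:R%:E <= @chain_hitting_time R d T dV V Y B w) =
  `[< forall m, (0 < m < n)%N -> ~ B (Y m w) >].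
Proof.
apply/idP/asboolP => [nle m /andP[m0 mn] BY|h].
  have : (n%:R%:E <= m%:R%:E :> \bar R)%E.
    by apply: (le_trans nle); apply: ereal_inf_lbound; exists m.
  by rewrite lee_fin ler_nat leqNgt mn.
apply: le_ereal_inf_tmp => _ [m [m0 BY] <-]; rewrite lee_fin ler_nat leqNgt.
by apply/negP => mn; apply: (h m) => //; rewrite m0.
Qed.

Lemma absorbed_first Y B w : ~ (\bigcap_n alive Y B n) w ->
  exists2 n, alive Y B n w & B (Y n.+1 w).
Proof.
move=> /existsNP[n /not_implyP[_]].
elim: n => [|n ih]; first by rewrite alive0 => /(_ Logic.I).
rewrite aliveS => /not_andP; have [al|nal] := pselect (alive Y B n w).
  by move=> [//|/contrapT ?]; exists n.
by move=> _; exact: ih.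
Qed.

Lemma sum_until_hitting Y B w n (F : nat -> \bar R) :
    alive Y B n w -> B (Y n.+1 w) ->
  \sum_(1 <= i <oo | i%:R%:E <= @chain_hitting_time R d T dV V Y B w) F i =
  \sum_(i < n.+1) F i.+1.
Proof.
move=> al hit.
have predE i : (0 < i)%N ->
    (i%:R%:E <= @chain_hitting_time R d T dV V Y B w) = (i <= n.+1)%N.
  move=> i0; rewrite le_chain_hitting_time; apply/asboolP/idP => [h|ile m].
    by rewrite leqNgt; apply/negP => ni; apply: (h n.+1) => //=.
  by move=> /andP[m0 mi]; apply: al; rewrite m0 -ltnS (leq_trans mi).
have sumE j : (n.+2 <= j)%N ->
    \sum_(1 <= i < j | i%:R%:E <= @chain_hitting_time R d T dV V Y B w) F i =
    \sum_(i < n.+1) F i.+1.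
  move=> nj; rewrite (@big_cat_nat _ _ _ n.+2)//= [X in _ + X]big_nat_cond.
  rewrite [X in _ + X]big_pred0 ?adde0; last first.
    move=> i; apply/negbTE/negP => /andP[/andP[ni _]].
    by rewrite predE ?(leq_trans _ ni)// leqNgt ni.
  rewrite -(big_mkord xpredT (fun i => F i.+1)) big_add1 /=.
  rewrite [LHS]big_nat_cond [RHS]big_nat_cond; apply: eq_bigl => i.
  by rewrite andbT predE//= andbb.
apply: cvg_lim => //; apply: cvg_near_cst.
by exists n.+2 => // j /= nj; exact: sumE.
Qed.

End path_functionals.

Section flow_density_version.
Context (R : realType) d (T : measurableType d).
Variables Phi K : {finite_measure set (T * T)%type -> \bar R}.
Hypothesis PhiK : Phi `<< K.

(** The Radon-Nikodym derivative of a signed measure may take negative values on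
    a null set.  A version that is nonnegative and real-valued everywhere allows
    divisions and a change of variables for all nonnegative functions. *)
Lemma flow_density_version : exists f : T * T -> R,
  [/\ measurable_fun setT f, forall z, (0 <= f z)%R,
      exists N, [/\ measurable N, K N = 0 &
        forall z, ~ N z -> flow_density Phi K z = (f z)%:E] &
      forall g : T * T -> \bar R, measurable_fun setT g ->
        (forall z, 0 <= g z) -> \int[Phi]_z g z = \int[K]_z (g z * (f z)%:E)].
Proof.
pose F := Radon_Nikodym_SigmaFinite.f Phi K.
have F0 z : 0 <= F z by exact: Radon_Nikodym_SigmaFinite.f_ge0.
have Ffin z : F z \is a fin_num by exact: Radon_Nikodym_SigmaFinite.f_fin_num.
have mF : measurable_fun setT F.
  exact: measurable_int (Radon_Nikodym_SigmaFinite.f_integrable _).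
exists (fine \o F); split.
- exact: measurableT_comp.
- by move=> z; exact/fine_ge0.
- have [N [mN N0 NF]] := ae_eq_Radon_Nikodym_SigmaFinite PhiK measurableT.
  exists N; split => // z /= nNz; rewrite fineK//.
  apply: contrapT => neq; apply: nNz; apply: NF => /= /(_ Logic.I) eqF.
  exact: (neq (esym eqF)).
- move=> g mg g0; rewrite -(Radon_Nikodym_SigmaFinite.change_of_variables PhiK)//.
  by apply: eq_integral => z _; rewrite /= fineK.
Qed.

End flow_density_version.

(** Cauchy-Schwarz in tangent form: with c the inverse of the sum of the f i,
    sum the inequalities 2 c a - c^2 f <= a^2 / f, which say that
    (a - c f)^2 / f is nonnegative. *)
Lemma inv_sum_le_energy (R : realFieldType) n (a f : nat -> R) :
    (forall i, (i <= n)%N -> (0 < f i)%R) -> (\sum_(i < n.+1) a i = 1)%R ->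
  ((\sum_(i < n.+1) f i)^-1 <= \sum_(i < n.+1) (a i) ^+ 2 / f i)%R.
Proof.
move=> f0 a1; set S := (\sum_(i < n.+1) f i)%R; set c := (S^-1)%R.
have S0 : (0 < S)%R.
  rewrite /S big_ord_recl /= ltr_pwDl ?f0// sumr_ge0// => i _.
  by apply/ltW/f0; rewrite /bump leq0n add1n.
have -> : c = (\sum_(i < n.+1) (2 * c * a i - c ^+ 2 * f i))%R.
  by rewrite sumrB -!mulr_sumr a1 -/S /c; field; rewrite gt_eqF.
apply: ler_sum => i _; have fi : (0 < f i)%R by apply: f0; rewrite -ltnS.
have -> : ((a i) ^+ 2 / f i = 2 * c * a i - c ^+ 2 * f i + (a i - c * f i) ^+ 2 / f i)%R.
  by field; rewrite gt_eqF.
by rewrite lerDl divr_ge0// ?sqr_ge0// ltW.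
Qed.

Section flow_value_bounds.
Context (R : realType) d (T : measurableType d) dV (V : measurableType dV).
Variables (A B : set T) (Phi K : {finite_measure set (T * T)%type -> \bar R}).
Variables (Q : probability V R) (Y : nat -> V -> T).
Hypotheses (mA : measurable A) (mB : measurable B).
Hypotheses (flow : unit_flow A B Phi) (chain : flow_chain A Phi Q Y).
Hypothesis PhiK : Phi `<< K.

(** What a path of the chain looks like almost surely: it starts in A, is
    absorbed in B at a finite time, and until then avoids any prescribed
    Phi-null set of edges. *)
Lemma chain_path_ae E : measurable E -> Phi E = 0 ->
  exists N, [/\ measurable N, Q N = 0 & forall w, ~ N w ->
    A (Y 0%N w) /\
    exists n, [/\ alive Y B n w, B (Y n.+1 w) &
      forall i, (i <= n)%N -> ~ E (Y i w, Y i.+1 w)]].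
Proof.
move=> mE E0; have mY := measurable_chain chain.
have mal := measurable_alive mB chain.
pose N0 := Y 0%N @^-1` (~` A).
pose N1 := \bigcap_n alive Y B n.
pose N2 := \bigcup_n (alive Y B n `&` [set w | E (Y n w, Y n.+1 w)]).
have mN0 : measurable N0.
  by rewrite -[X in measurable X]setTI; apply: mY => //; exact: measurableC.
have mN1 : measurable N1 by exact: bigcapT_measurable.
have mstep n : measurable (alive Y B n `&` [set w | E (Y n w, Y n.+1 w)]).
  apply: measurableI => //.
  by rewrite -[X in measurable X]setTI; exact: (measurable_step chain n).
have mN2 : measurable N2 by exact: bigcupT_measurable.
have QN0 : Q N0 = 0.
  have [l [_ [_ start _]]] := chain.
  by rewrite start ?setICr ?/out_flow ?set0X ?measure0//; exact: measurableC.
have QN2 : Q N2 = 0.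
  apply/eqP; rewrite eq_le measure_ge0 andbT.
  apply: (le_trans (measure_sigma_subadditive Q mstep mN2 (@subset_refl _ _))).
  by rewrite eseries0// => n _ _; apply: (null_step mA mB flow chain).
exists (N0 `|` N1 `|` N2); split.
- by apply: measurableU => //; exact: measurableU.
- rewrite measureU0//; first rewrite measureU0//; first exact: (never_absorbed_null mA mB flow chain).
  exact: measurableU.
- move=> w /not_orP[/not_orP[nN0 nN1] nN2]; split; first exact: contrapT.
  have [n al hit] := absorbed_first nN1; exists n; split => // i ni Ei.
  by apply: nN2; exists i => //; split => //; apply: alive_le al.
Qed.

Variable h : T -> R.
Hypotheses (mh : measurable_fun setT h) (hA : forall x, A x -> h x = 1%R)
  (hB : forall x, B x -> h x = 0%R).

Let mh12 : measurable_fun setT (fun z : T * T => h z.1 - h z.2)%R.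
Proof. by apply: measurable_funB; exact: measurableT_comp. Qed.

Lemma telescope_potential w n : A (Y 0%N w) -> B (Y n.+1 w) ->
  (\sum_(i < n.+1) (h (Y i w) - h (Y i.+1 w)) = 1)%R.
Proof.
move=> AY BY.
rewrite (eq_bigr (fun i : 'I_n.+1 => - (h (Y i.+1 w) - h (Y i w)))%R); last first.
  by move=> i _; rewrite opprB.
rewrite sumrN -(big_mkord xpredT (fun i => h (Y i.+1 w) - h (Y i w))%R).
by rewrite telescope_sumr// (hA AY) (hB BY) sub0r opprK.
Qed.

(** The bound by Cauchy-Schwarz along each path, followed by the bound of
    expected passages by Phi; since Phi has density f with respect to K, the
    factor 1 / f cancels. *)
Lemma flow_value_le_energy chi : measurable chi -> Phi (~` chi) = 0 ->
  flow_value Phi K Q Y B <= \int[K]_(z in chi) ((h z.1 - h z.2) ^+ 2)%:E.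
Proof.
move=> mchi chi0.
have [f [mf f0 [N0 [mN0 KN0 Nf]] Phif]] := flow_density_version PhiK.
have mf0 : measurable [set z | f z = 0%R].
  by rewrite -[X in measurable X]setTI; exact: (mf measurableT [set 0%R]).
have Phif0 : Phi [set z | f z = 0%R] = 0.
  transitivity (\int[Phi]_z (\1_[set z | f z = 0%R] z)%:E).
    by rewrite integral_indic// setIT.
  rewrite Phif; [|exact/measurable_EFinP/measurable_indic|by move=> z; rewrite lee_fin].
  rewrite integral0_eq// => z _; rewrite indicE.
  by have [|] := boolP (z \in _); rewrite ?mul0e// inE /= => ->; rewrite mule0.
(* the edges that the chain almost surely avoids *)
pose E := N0 `|` [set z | f z = 0%R] `|` ~` chi.
have mNf : measurable (N0 `|` [set z | f z = 0%R]) by exact: measurableU.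
have mE : measurable E by apply: measurableU => //; exact: measurableC.
have PhiE : Phi E = 0.
  rewrite measureU0//; last exact: measurableC.
  by rewrite measureU0//; exact: ((null_content_dominatesP _ _).1 PhiK).
have [N [mN QN path]] := chain_path_ae mE PhiE.
pose g z := (\1_chi z * ((h z.1 - h z.2) ^+ 2 / f z))%R.
have g0 z : (0 <= g z)%R by rewrite mulr_ge0// divr_ge0// sqr_ge0.
have mg : measurable_fun setT g.
  apply: measurable_funM; first exact: measurable_indic.
  apply: measurable_funM; first exact: measurable_funX.
  have -> : (fun z => (f z)^-1)%R = (fun z => f z `^ (-1))%R.
    by apply/funext => z; rewrite powR_inv1.
  exact: (measurableT_comp (measurable_powR _)).
pose G w := \sum_(n <oo) ((fun w => (g (Y n w, Y n.+1 w))%:E) \_ (alive Y B n)) w.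
have Gn0 n w : 0 <= ((fun w => (g (Y n w, Y n.+1 w))%:E) \_ (alive Y B n)) w.
  by rewrite patchE; case: ifPn => // _; rewrite lee_fin.
have mGn n : measurable_fun setT
    ((fun w => (g (Y n w, Y n.+1 w))%:E) \_ (alive Y B n)).
  apply: (measurable_restrictT _ (measurable_alive mB chain n)).1.
  apply: measurable_funTS; apply/measurable_EFinP.
  exact: (measurableT_comp mg (measurable_step chain n)).
apply: (@le_trans _ _ (\int[Q]_w G w)).
  apply: (integral_le_off_null mN QN).
  - exact: ge0_emeasurable_sum.
  - by move=> w; exact: nneseries_ge0.
  move=> w /path[AY [n [al hit good]]].
  rewrite (sum_until_hitting _ al hit).
  have fE i : (i <= n)%N ->
      flow_density Phi K (Y i w, Y i.+1 w) = (f (Y i w, Y i.+1 w))%:E.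
    by move=> /good nE; apply: Nf => ?; apply: nE; left; left.
  have fpos i : (i <= n)%N -> (0 < f (Y i w, Y i.+1 w))%R.
    move=> /good nE; rewrite lt_neqAle f0 andbT eq_sym.
    by apply/eqP => fz; apply: nE; left; right.
  have inchi i : (i <= n)%N -> chi (Y i w, Y i.+1 w).
    by move=> /good nE; apply: contrapT => nchi; apply: nE; right.
  rewrite (eq_bigr (fun i : 'I_n.+1 => (f (Y i w, Y i.+1 w))%:E)); last first.
    by move=> i _; apply: fE; rewrite /= -ltnS.
  rewrite sumEFin.
  have S0 : (\sum_(i < n.+1) f (Y i w, Y i.+1 w) != 0)%R.
    rewrite gt_eqF// big_ord_recl /= ltr_pwDl ?fpos//.
    by apply: sumr_ge0.
  rewrite /inve /= (negbTE S0).
  apply: (@le_trans _ _ (\sum_(i < n.+1) g (Y i w, Y i.+1 w))%:E).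
    rewrite lee_fin.
    have := @inv_sum_le_energy _ n (fun i => h (Y i w) - h (Y i.+1 w))%R
      (fun i => f (Y i w, Y i.+1 w)) fpos (telescope_potential AY hit).
    move=> /le_trans; apply.
    apply: ler_sum => i _.
    have chi_i : chi (Y i w, Y i.+1 w) by apply: inchi; rewrite -ltnS.
    by rewrite /g indicE (mem_set chi_i) mul1r.
  rewrite -sumEFin.
  apply: (@le_trans _ _ (\sum_(0 <= i < n.+1) ((fun w => (g (Y i w, Y i.+1 w))%:E) \_ (alive Y B i)) w)).
    rewrite big_mkord; apply: lee_sum => i _; rewrite patchE mem_set//.
    by apply: alive_le al; rewrite -ltnS.
  exact: nneseries_lim_ge.
rewrite integral_nneseries//.
apply: lime_le; first by apply: is_cvg_nneseries => n _ _; exact: integral_ge0.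
apply: nearW => n; rewrite big_mkord.
rewrite (eq_bigr (fun i : 'I_n => \int[Q]_(w in alive Y B i) (g (Y i w, Y i.+1 w))%:E)); last first.
  by move=> i _; rewrite -integral_mkcond.
apply: (le_trans (@expected_passages_le _ _ _ _ _ _ _ _ _ _ mA mB flow chain n
  (fun z => (g z)%:E) _ _)).
- exact/measurable_EFinP.
- by move=> z; rewrite lee_fin.
rewrite Phif; [|exact/measurable_EFinP|by move=> z; rewrite lee_fin].
  rewrite [leRHS]integral_mkcond; apply: ge0_le_integral => //.
  - by move=> z _; rewrite -EFinM lee_fin mulr_ge0.
  - by apply: emeasurable_funM; exact/measurable_EFinP.
  - apply: (measurable_restrictT _ mchi).1; apply: measurable_funTS.
    exact/measurable_EFinP/measurable_funX.
  move=> z _; rewrite -EFinM patchE /g indicE.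
  case: ifPn => _; last by rewrite !mul0r.
  rewrite mul1r lee_fin; have [->|fz] := eqVneq (f z) 0%R.
    by rewrite mulr0 sqr_ge0.
  by rewrite mulfVK.
Qed.

(** If the density is the normalised decrease of h, the sum of the densities
    along a path telescopes to 1 / c. *)
Lemma flow_value_gradient (c : R) N0 : (0 < c)%R -> measurable N0 -> K N0 = 0 ->
    (forall z, ~ N0 z ->
      flow_density Phi K z = (Num.max (h z.1 - h z.2) 0 / c)%:E) ->
    Phi [set z | (h z.1 - h z.2 <= 0)%R] = 0 ->
  flow_value Phi K Q Y B = c%:E.
Proof.
move=> c0 mN0 KN0 density Phile0.
pose E := N0 `|` [set z : T * T | (h z.1 - h z.2 <= 0)%R].
have mle0 : measurable [set z : T * T | (h z.1 - h z.2 <= 0)%R].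
  have -> : [set z : T * T | (h z.1 - h z.2 <= 0)%R] =
      (fun z : T * T => h z.1 - h z.2)%R @^-1` `]-oo, 0%R]%classic.
    by apply/seteqP; split => z /=; rewrite in_itv.
  by rewrite -[X in measurable X]setTI; exact: mh12.
have mE : measurable E by exact: measurableU.
have PhiE : Phi E = 0.
  rewrite measureU0//; exact: ((null_content_dominatesP _ _).1 PhiK).
have [N [mN QN path]] := chain_path_ae mE PhiE.
have integrandE w : ~ N w ->
    (\sum_(1 <= i <oo | i%:R%:E <= @chain_hitting_time R d T dV V Y B w)
       flow_density Phi K (Y i.-1 w, Y i w))^-1 = c%:E.
  move=> /path[AY [n [al hit good]]].
  rewrite (sum_until_hitting _ al hit).
  rewrite (eq_bigr (fun i : 'I_n.+1 => (c^-1 * (h (Y i w) - h (Y i.+1 w)))%:E)).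
    rewrite sumEFin -mulr_sumr telescope_potential// mulr1.
    by rewrite /inve /= invr_eq0 (gt_eqF c0) invrK.
  move=> i _; have /good nE : (i <= n)%N by rewrite -ltnS.
  rewrite /= density; last by move=> ?; apply: nE; left.
  rewrite /= mulrC max_l//.
  by apply/ltW; rewrite ltNge; apply/negP => ?; apply: nE; right.
have constE : \int[Q]_w cst c%:E w = c%:E.
  by rewrite integral_cst// [X in _ * X]probability_setT mule1.
apply/eqP; rewrite eq_le; apply/andP; split; rewrite -[X in X%:E]/c -constE.
  apply: (integral_le_off_null mN QN) => // [w|w /integrandE ->//].
  by rewrite lee_fin ltW.
apply: (integral_ge_off_null mN QN) => // [w|w /integrandE ->//].
by rewrite lee_fin ltW.
Qed.

End flow_value_bounds.

(** * Energy of the equilibrium potential *)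

Section bounded_measurable.
Context (R : realType) d (X : measurableType d).
Implicit Types f g : X -> R.

(** A class of integrable functions for a finite measure that is stable under
    sums, products and positive parts; it reduces all integrability conditions
    below to syntax. *)
Definition bounded_measurable f :=
  measurable_fun setT f /\ exists M, forall x, (`|f x| <= M)%R.

Lemma bounded_measurableD f g : bounded_measurable f -> bounded_measurable g ->
  bounded_measurable (fun x => f x + g x)%R.
Proof.
move=> [mf [M fM]] [mg [N gN]]; split; first exact: measurable_funD.
by exists (M + N)%R => x; rewrite (le_trans (ler_normD _ _))// lerD.
Qed.

Lemma bounded_measurableM f g : bounded_measurable f -> bounded_measurable g ->
  bounded_measurable (fun x => f x * g x)%R.
Proof.
move=> [mf [M fM]] [mg [N gN]]; split; first exact: measurable_funM.
by exists (M * N)%R => x; rewrite normrM ler_pM.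
Qed.

Lemma bounded_measurable_cst (r : R) : bounded_measurable (fun=> r).
Proof. by split => //; exists `|r|%R. Qed.

Lemma bounded_measurableN f : bounded_measurable f ->
  bounded_measurable (fun x => - f x)%R.
Proof.
move=> [mf [M fM]]; split; first exact: measurableT_comp.
by exists M => x; rewrite normrN.
Qed.

Lemma bounded_measurable_indic C : measurable C ->
  bounded_measurable (\1_C : X -> R).
Proof.
move=> mC; split; first exact: measurable_indic.
by exists 1%R => x; rewrite indicE ger0_norm// lern1 leq_b1.
Qed.

Lemma bounded_measurable_max0 f : bounded_measurable f ->
  bounded_measurable (fun x => Num.max (f x) 0)%R.
Proof.
move=> [mf [M fM]]; split; first exact: measurable_maxr.
exists M => x; apply: le_trans (fM x); rewrite /Num.max; case: ifPn => // _.
by rewrite normr0.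
Qed.

Variable m : {finite_measure set X -> \bar R}.

Lemma bounded_measurable_integrable f : bounded_measurable f ->
  m.-integrable setT (EFin \o f).
Proof.
move=> [mf [M fM]]; apply: measurable_bounded_integrable => //.
  by rewrite ltey_eq fin_num_measure.
exists M; split; first exact: num_real.
by move=> M' MM' x _ /=; rewrite (le_trans (fM x))// ltW.
Qed.

Lemma bRintegralD f g : bounded_measurable f -> bounded_measurable g ->
  (\int[m]_x (f x + g x) = \int[m]_x f x + \int[m]_x g x)%R.
Proof. by move=> bf bg; rewrite RintegralD//; exact: bounded_measurable_integrable. Qed.

Lemma bRintegralB f g : bounded_measurable f -> bounded_measurable g ->
  (\int[m]_x (f x - g x) = \int[m]_x f x - \int[m]_x g x)%R.
Proof. by move=> bf bg; rewrite RintegralB//; exact: bounded_measurable_integrable. Qed.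

Lemma bRintegralE f : bounded_measurable f ->
  \int[m]_x (f x)%:E = (\int[m]_x f x)%R%:E.
Proof.
move=> bf; rewrite /Rintegral fineK//; apply: integrable_fin_num => //.
exact: bounded_measurable_integrable.
Qed.

End bounded_measurable.

Section reversible_edge_measure.
Context (R : realType) d (T : measurableType d).
Variables (mu : {measure set T -> \bar R}) (k : R.-ker T ~> T).
Variables (K : {finite_measure set (T * T)%type -> \bar R}).
Hypotheses (kfin : forall x, k x setT < +oo) (rev : reversible mu k).
Hypothesis edge : edge_measure mu k K.

Lemma integral_edge (f : T * T -> \bar R) :
    measurable_fun setT f -> (forall z, 0 <= f z) ->
  \int[K]_z f z = \int[mu]_x \int[k x]_y f (x, y).
Proof. by move=> mf f0; exact: integral_disintegration. Qed.

Let mswap : measurable_fun setT (@swap_pair T T) := @measurable_swap _ _ T T.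

Lemma edge_swap E : measurable E -> K (@swap_pair T T @^-1` E) = K E.
Proof.
move=> mE.
have mE' : measurable (@swap_pair T T @^-1` E).
  by rewrite -[X in measurable X]setTI; exact: mswap.
by rewrite !edge// rev.
Qed.

Lemma Rintegral_edge_swap (f : T * T -> R) : bounded_measurable f ->
  (\int[K]_z f (z.2, z.1) = \int[K]_z f z)%R.
Proof.
move=> [mf [M fM]]; rewrite /Rintegral; congr fine.
pose K' := image_measure K mswap.
transitivity (\int[K']_z (f z)%:E); last first.
  by apply: eq_measure_integral => E mE _; exact: edge_swap.
rewrite [RHS](integral_pushforward mswap)//.
- exact/measurable_EFinP.
- apply: (@bounded_measurable_integrable _ _ _ K (f \o @swap_pair T T)).
  by split; [exact: measurableT_comp|exists M => z; exact: fM].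
Qed.

(** For a disintegrated measure it is enough to compare the inner integrals. *)
Lemma eq_Rintegral_edge (f g : T * T -> R) :
    bounded_measurable f -> bounded_measurable g ->
    (forall z, 0 <= f z)%R -> (forall z, 0 <= g z)%R ->
    (forall x, \int[k x]_y (f (x, y))%:E = \int[k x]_y (g (x, y))%:E) ->
  (\int[K]_z f z = \int[K]_z g z)%R.
Proof.
move=> [mf _] [mg _] f0 g0 fg; rewrite /Rintegral; congr fine.
rewrite !integral_edge//; [|exact/measurable_EFinP|exact/measurable_EFinP].
by apply: eq_integral => x _; rewrite fg.
Qed.

End reversible_edge_measure.

Lemma bounded_measurable_fst (R : realType) d (X : measurableType d) d'
    (S : measurableType d') (f : X -> R) :
  bounded_measurable f -> bounded_measurable (fun z : X * S => f z.1).
Proof. by move=> [mf [M fM]]; split; [exact: measurableT_comp|exists M]. Qed.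

Lemma bounded_measurable_snd (R : realType) d (X : measurableType d) d'
    (S : measurableType d') (f : S -> R) :
  bounded_measurable f -> bounded_measurable (fun z : X * S => f z.2).
Proof. by move=> [mf [M fM]]; split; [exact: measurableT_comp|exists M]. Qed.

Ltac bounded_measurability := repeat first
  [ assumption
  | exact: bounded_measurable_cst
  | apply: bounded_measurable_max0
  | apply: bounded_measurableD
  | apply: bounded_measurableN
  | apply: bounded_measurableM
  | apply: bounded_measurable_fst
  | apply: bounded_measurable_snd
  | apply: bounded_measurable_indic ].

Section equilibrium_potential.
Context (R : realType) d (T : measurableType d).
Variables (mu : {measure set T -> \bar R}) (k : R.-ker T ~> T).
Variables (K : {finite_measure set (T * T)%type -> \bar R}).
Hypotheses (kfin : forall x, k x setT < +oo) (rev : reversible mu k).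
Hypothesis edge : edge_measure mu k K.
Variables (A B : set T) (h : T -> R).
Hypotheses (mA : measurable A) (mB : measurable B) (AB0 : A `&` B = set0).
Hypotheses (mh : measurable_fun setT h) (h01 : forall x, (0 <= h x <= 1)%R).
Hypotheses (hA : forall x, A x -> h x = 1%R) (hB : forall x, B x -> h x = 0%R).
Hypothesis harm : forall x, ~ A x -> ~ B x ->
  \int[k x]_y (h y)%:E = (h x)%:E * k x setT.

Let h0 x : (0 <= h x)%R. Proof. by case/andP: (h01 x). Qed.
Let h1 x : (h x <= 1)%R. Proof. by case/andP: (h01 x). Qed.
Let bh : bounded_measurable h.
Proof. by split => //; exists 1%R => x; rewrite ger0_norm. Qed.

Let C : set T := ~` (A `|` B).
Let mC : measurable C. Proof. by apply: measurableC; exact: measurableU. Qed.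

(** The flux of the gradient of h out of A.  For the hitting probability it is
    the capacity, see capacity_outflow. *)
Definition outflow : R := (\int[K]_z (\1_A z.1 * (1 - h z.2)))%R.

Lemma outflow_ge0 : (0 <= outflow)%R.
Proof. by apply: Rintegral_ge0 => z _; rewrite mulr_ge0// subr_ge0. Qed.

Let mhE : measurable_fun setT (fun y => (h y)%:E).
Proof. exact/measurable_EFinP. Qed.

Let integral_hZ x (r : R) : (0 <= r)%R ->
  \int[k x]_y (r * h y)%:E = r%:E * \int[k x]_y (h y)%:E.
Proof.
move=> r0; under eq_integral do rewrite EFinM.
by rewrite ge0_integralZl// => y _; rewrite lee_fin.
Qed.

Lemma potential_balance D : measurable D -> D `<=` C ->
  (\int[K]_z (\1_D z.1 * h z.1) = \int[K]_z (\1_D z.1 * h z.2))%R.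
Proof.
move=> mD DC; apply: (eq_Rintegral_edge kfin edge); [by bounded_measurability..| | |].
- by move=> z; rewrite mulr_ge0.
- by move=> z; rewrite mulr_ge0.
move=> x /=; rewrite integral_hZ//; have [xD|xD] := boolP (x \in D); last first.
  rewrite indicE (negbTE xD) mul0e integral0_eq// => y _.
  by rewrite mul0r.
have [nA nB] : ~ A x /\ ~ B x by apply/not_orP/DC/set_mem.
by rewrite harm// integral_cst// EFinM muleA.
Qed.

(** Integrate over the second point of the edge first.  Off A and B harmonicity
    turns h(x) h(y) into h(x)^2, on B both vanish, and on A the defect is the
    mean of 1 - h. *)
Lemma energy_decomposition :
  (\int[K]_z (h z.1 * h z.1) = \int[K]_z (h z.1 * h z.2) + outflow)%R.
Proof.
rewrite /outflow -bRintegralD; [|by bounded_measurability..].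
apply: (eq_Rintegral_edge kfin edge); [by bounded_measurability..| | |].
- by move=> z; rewrite mulr_ge0.
- by move=> z; rewrite addr_ge0// mulr_ge0// subr_ge0.
move=> x /=; have [Ax|nAx] := pselect (A x).
  rewrite indicE mem_set// hA//; apply: eq_integral => y _.
  by rewrite !mul1r; congr EFin; ring.
rewrite indicE memNset//.
under [RHS]eq_integral do rewrite mul0r addr0.
rewrite integral_hZ//; have [Bx|nBx] := pselect (B x).
  by rewrite hB// mul0e integral0_eq// => y _; rewrite mul0r.
by rewrite harm// integral_cst// EFinM muleA.
Qed.

(** By symmetry of K the set chi and its reverse carry the same energy, and they
    are disjoint; so twice the energy on chi is at most the total energy, which is
    twice the outflow by energy_decomposition. *)
Lemma antisymmetric_energy_le chi : measurable chi ->
    (forall x y, chi (x, y) -> ~ chi (y, x)) ->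
  \int[K]_(z in chi) ((h z.1 - h z.2) ^+ 2)%:E <= outflow%:E.
Proof.
move=> mchi anti.
pose D2 (z : T * T) : R := ((h z.1 - h z.2) * (h z.1 - h z.2))%R.
have bD2 : bounded_measurable D2 by rewrite /D2; bounded_measurability.
pose chiT := @swap_pair T T @^-1` chi.
have mchiT : measurable chiT.
  by rewrite -[X in measurable X]setTI; exact: (@measurable_swap _ _ T T).
have bc : bounded_measurable (fun z => \1_chi z * D2 z)%R by bounded_measurability.
have bcT : bounded_measurable (fun z => \1_chiT z * D2 z)%R by bounded_measurability.
have -> : \int[K]_(z in chi) ((h z.1 - h z.2) ^+ 2)%:E =
    (\int[K]_z (\1_chi z * D2 z))%R%:E.
  rewrite -bRintegralE// integral_mkcond; apply: eq_integral => z _.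
  by rewrite patchE indicE /D2; case: ifPn => _; rewrite ?mul1r ?mul0r// -expr2.
have swapE : (\int[K]_z (\1_chiT z * D2 z) = \int[K]_z (\1_chi z * D2 z))%R.
  rewrite -[RHS](Rintegral_edge_swap rev edge bc).
  apply: eq_Rintegral => z _; rewrite /D2 /=; congr (_ * _)%R; ring.
have chi_le : (\int[K]_z (\1_chi z * D2 z) + \int[K]_z (\1_chiT z * D2 z) <=
    \int[K]_z D2 z)%R.
  rewrite -bRintegralD//; apply: le_Rintegral => //.
  - by apply: bounded_measurable_integrable; bounded_measurability.
  - exact: bounded_measurable_integrable.
  move=> [x y] _; rewrite -mulrDl !indicE.
  have D0 : (0 <= D2 (x, y))%R by rewrite /D2 /= -expr2 sqr_ge0.
  have [xy|_] := boolP ((x, y) \in chi); last first.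
    by rewrite add0r; case: (_ \in _); rewrite ?mul1r ?mul0r.
  by rewrite memNset ?addr0 ?mul1r//; exact: (anti _ _ (set_mem xy)).
have D2E : (\int[K]_z D2 z = 2 * outflow)%R.
  have -> : (\int[K]_z D2 z = \int[K]_z (h z.1 * h z.1 - h z.1 * h z.2) +
      \int[K]_z (h z.2 * h z.2 - h z.2 * h z.1))%R.
    rewrite -bRintegralD; [|by bounded_measurability..].
    by apply: eq_Rintegral => z _; rewrite /D2; ring.
  have -> : (\int[K]_z (h z.2 * h z.2 - h z.2 * h z.1) =
      \int[K]_z (h z.1 * h z.1 - h z.1 * h z.2))%R.
    apply: (Rintegral_edge_swap rev edge
      (f := fun z => h z.1 * h z.1 - h z.1 * h z.2)%R).
    by bounded_measurability.
  rewrite bRintegralB; [|by bounded_measurability..].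
  by rewrite energy_decomposition; ring.
by rewrite lee_fin; move: chi_le; rewrite swapE D2E; lra.
Qed.

Let u (z : T * T) : R := Num.max (h z.1 - h z.2)%R 0%R.

Let u0 z : (0 <= u z)%R. Proof. by rewrite /u le_max lexx orbT. Qed.

Let bu : bounded_measurable u.
Proof. by rewrite /u; bounded_measurability. Qed.

Lemma gradient_outflow :
  (\int[K]_z (\1_A z.1 * u z) = outflow)%R.
Proof.
apply: eq_Rintegral => z _; rewrite indicE.
have [/set_mem Az|] := boolP (z.1 \in A); last by rewrite !mul0r.
by rewrite /u hA// max_l// subr_ge0.
Qed.

(** After reversing the edges on the right, the difference of the integrands is
    h(x) - h(y), whose integral over the edges that start in D vanishes by
    harmonicity. *)
Lemma gradient_balance D : measurable D -> D `<=` C ->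
  (\int[K]_z (\1_D z.1 * u z) = \int[K]_z (\1_D z.2 * u z))%R.
Proof.
move=> mD DC.
have bD1 : bounded_measurable (fun z : T * T => \1_D z.1 : R) by bounded_measurability.
rewrite -[RHS](Rintegral_edge_swap rev edge); last by bounded_measurability.
apply/eqP; rewrite -subr_eq0 -bRintegralB; last 2 first.
- by bounded_measurability.
- by rewrite /u /=; bounded_measurability.
rewrite (@eq_Rintegral _ _ _ _ _ (fun z => \1_D z.1 * h z.1 - \1_D z.1 * h z.2)%R).
  rewrite bRintegralB; [|by bounded_measurability..].
  by rewrite potential_balance// subrr.
move=> z _; rewrite /u /= -!mulrBr; congr (_ * _)%R.
by rewrite /Num.max; do 2 case: ifPn; rewrite -?leNgt; lra.
Qed.

(** The total flow is unchanged when all edges are reversed.  Splitting both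
    totals according to the starting point, the parts off A and B agree by
    gradient_balance, so what leaves A equals what enters B. *)
Lemma gradient_inflow :
  (\int[K]_z (\1_B z.2 * u z) = outflow)%R.
Proof.
pose v (z : T * T) : R := u (z.2, z.1).
have bv : bounded_measurable v by rewrite /v /u /=; bounded_measurability.
have bI D (mD : measurable D) : bounded_measurable (fun z : T * T => \1_D z.1 : R).
  by bounded_measurability.
(* A, B and the complement of their union form a partition of the starting points *)
have split3 w : bounded_measurable w -> (\int[K]_z w z = \int[K]_z (\1_A z.1 * w z) +
    \int[K]_z (\1_B z.1 * w z) + \int[K]_z (\1_C z.1 * w z))%R.
  move=> bw; rewrite -!bRintegralD; [|by bounded_measurability..].
  apply: eq_Rintegral => z _; rewrite -!mulrDl.
  suff -> : (\1_A z.1 + \1_B z.1 + \1_C z.1 = 1 :> R)%R by rewrite mul1r.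
  rewrite !indicE /C; have [Az|nAz] := pselect (A z.1).
    have nBz : ~ B z.1 by move=> Bz; have : (A `&` B) z.1 by []; rewrite AB0.
    by rewrite mem_set// memNset// memNset ?addr0//; apply; left.
  have [Bz|nBz] := pselect (B z.1).
    by rewrite memNset// mem_set// memNset ?addr0 ?add0r//; apply; right.
  by rewrite memNset// memNset// mem_set ?add0r// => -[].
have swapv D : measurable D ->
    (\int[K]_z (\1_D z.1 * v z) = \int[K]_z (\1_D z.2 * u z))%R.
  move=> mD; apply: (Rintegral_edge_swap rev edge
    (f := fun z => \1_D z.2 * u z)%R).
  by bounded_measurability.
have Bu0 : (\int[K]_z (\1_B z.1 * u z) = 0)%R.
  rewrite /Rintegral integral0_eq// => z _; rewrite indicE.
  have [/set_mem Bz|] := boolP (z.1 \in B); last by rewrite mul0r.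
  by rewrite /u hB// max_r ?mulr0// sub0r oppr_le0.
have Av0 : (\int[K]_z (\1_A z.1 * v z) = 0)%R.
  rewrite /Rintegral integral0_eq// => z _; rewrite indicE.
  have [/set_mem Az|] := boolP (z.1 \in A); last by rewrite mul0r.
  by rewrite /v /u /= (hA Az) max_r ?mulr0// subr_le0.
have := split3 _ bu; rewrite -[LHS](Rintegral_edge_swap rev edge)// (split3 v)//.
rewrite gradient_outflow (gradient_balance mC (@subset_refl _ _)) Bu0 Av0 !swapv//.
lra.
Qed.

End equilibrium_potential.

(** * The gradient flow of the equilibrium potential *)

Section gradient_flow.
Context (R : realType) d (T : measurableType d).
Variables (mu : {measure set T -> \bar R}) (k : R.-ker T ~> T).
Variables (K : {finite_measure set (T * T)%type -> \bar R}).
Hypotheses (kfin : forall x, k x setT < +oo) (rev : reversible mu k).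
Hypothesis edge : edge_measure mu k K.
Variables (A B : set T) (h : T -> R).
Hypotheses (mA : measurable A) (mB : measurable B) (AB0 : A `&` B = set0).
Hypotheses (mh : measurable_fun setT h) (h01 : forall x, (0 <= h x <= 1)%R).
Hypotheses (hA : forall x, A x -> h x = 1%R) (hB : forall x, B x -> h x = 0%R).
Hypothesis harm : forall x, ~ A x -> ~ B x ->
  \int[k x]_y (h y)%:E = (h x)%:E * k x setT.

Let c := outflow K A h.
Hypothesis c0 : (0 < c)%R.

Let u (z : T * T) : R := Num.max (h z.1 - h z.2)%R 0%R.

Let u0 z : (0 <= u z)%R. Proof. by rewrite /u le_max lexx orbT. Qed.

Let bu : bounded_measurable u.
Proof.
have bh : bounded_measurable h.
  by split => //; exists 1%R => x; rewrite ger0_norm; case/andP: (h01 x).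
by rewrite /u; bounded_measurability.
Qed.

Let buc : bounded_measurable (fun z => u z / c)%R.
Proof. by bounded_measurability. Qed.

Let uc0 z : (0 <= u z / c)%R. Proof. by rewrite divr_ge0// ltW. Qed.

(** Existence as a finite measure: a mixture of multiples of Dirac masses. *)
Lemma gradient_flow_exists : exists Phi : {finite_measure set (T * T)%type -> \bar R},
  forall E, measurable E -> Phi E = \int[K]_(z in E) (u z / c)%:E.
Proof.
pose N z : {measure set (T * T)%type -> \bar R} := mscale (NngNum (uc0 z)) (\d_z).
have NE z E : N z E = (u z / c)%:E * (\1_E z)%:E by [].
have mN E : measurable E -> measurable_fun setT (N ^~ E).
  move=> mE; under eq_fun do rewrite NE.
  apply: emeasurable_funM; apply/measurable_EFinP; first by case: buc.
  exact: measurable_indic.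
have [Phi PhiE] := mixture_exists K measurableT mN.
have PhiE' E : measurable E -> Phi E = \int[K]_(z in E) (u z / c)%:E.
  move=> mE; rewrite PhiE [RHS]integral_mkcond; apply: eq_integral => z _.
  rewrite NE patchE indicE; case: (z \in E) => /=; first by rewrite mule1.
  by rewrite mule0.
have Phioo : Phi setT < +oo by rewrite PhiE'// bRintegralE// ltry.
exists (mfrestr measurableT Phioo) => E mE.
by rewrite -PhiE'// -[in RHS](setIT E).
Qed.

Variable Phi : {finite_measure set (T * T)%type -> \bar R}.
Hypothesis PhiE : forall E, measurable E -> Phi E = \int[K]_(z in E) (u z / c)%:E.

Lemma gradient_flowE E : measurable E ->
  Phi E = (c^-1 * \int[K]_z (\1_E z * u z))%R%:E.
Proof.
move=> mE; rewrite PhiE// -RintegralZl//; last first.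
  by apply: bounded_measurable_integrable; bounded_measurability.
rewrite -bRintegralE; last by bounded_measurability.
rewrite integral_mkcond; apply: eq_integral => z _.
rewrite patchE indicE; case: (z \in E); first by rewrite mul1r mulrC.
by rewrite mul0r mulr0.
Qed.

Lemma gradient_flow_dominated : Phi `<< K.
Proof.
apply/null_content_dominatesP => E mE KE0; rewrite PhiE//.
by apply: null_set_integral => //; apply/measurable_EFinP/measurable_funTS; case: buc.
Qed.

Lemma gradient_flow_descends : Phi [set z | (h z.1 - h z.2 <= 0)%R] = 0.
Proof.
have mh12 : measurable_fun setT (fun z : T * T => h z.1 - h z.2)%R.
  by apply: measurable_funB; exact: measurableT_comp.
rewrite PhiE; last first.
  have -> : [set z : T * T | (h z.1 - h z.2 <= 0)%R] =
      (fun z : T * T => h z.1 - h z.2)%R @^-1` `]-oo, 0%R]%classic.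
    by apply/seteqP; split => z /=; rewrite in_itv.
  by rewrite -[X in measurable X]setTI; exact: mh12.
by rewrite integral0_eq// => z /= hz; rewrite /u max_r// mul0r.
Qed.

Let setX1 D : (fun z => \1_(D `*` setT) z * u z)%R = (fun z => \1_D z.1 * u z)%R.
Proof.
apply/funext => z; rewrite !indicE; congr (_%:R * _)%R; congr nat_of_bool.
by apply/idP/idP => /set_mem; [case=> ? _|move=> ?]; apply/mem_set.
Qed.

Let setX2 D : (fun z => \1_(setT `*` D) z * u z)%R = (fun z => \1_D z.2 * u z)%R.
Proof.
apply/funext => z; rewrite !indicE; congr (_%:R * _)%R; congr nat_of_bool.
by apply/idP/idP => /set_mem; [case=> _ ?|move=> ?]; apply/mem_set.
Qed.

(** The potential would decrease strictly around a loop. *)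
Lemma gradient_flow_no_loops :
  no_loops [set z : T * T | (0 < h z.1 - h z.2)%R].
Proof.
move=> n g n0 gn; apply: contrapT => nex.
have dec j : (1 <= j <= n)%N -> (h (g j) < h (g j.-1))%R.
  by move=> jn; apply: contrapT => nj; apply: nex; exists j => //= ; rewrite subr_gt0.
suff /(_ n) : forall m, (0 < m <= n)%N -> (h (g m) < h (g 0%N))%R.
  by rewrite n0 leqnn gn ltxx => /(_ isT).
elim=> [//|[|m] ih] mn; first exact: dec.
apply: lt_trans (dec _ mn) _; apply: ih.
by case/andP: mn => _ /ltnW ->.
Qed.

Lemma gradient_flow_loop_free : loop_free_unit_flow A B Phi.
Proof.
have mX1 D : measurable D -> measurable (D `*` [set: T]) by move=> ?; exact: measurableX.
have mX2 D : measurable D -> measurable ([set: T] `*` D) by move=> ?; exact: measurableX.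
have flowE E : measurable E ->
    (Phi : {measure set (T * T)%type -> \bar R}) E =
    (c^-1 * \int[K]_z (\1_E z * u z))%R%:E by exact: gradient_flowE.
have mh12 : measurable_fun setT (fun z : T * T => h z.1 - h z.2)%R.
  by apply: measurable_funB; exact: measurableT_comp.
have support : flow_support Phi [set z : T * T | (0 < h z.1 - h z.2)%R].
  split.
  - have -> : [set z : T * T | (0 < h z.1 - h z.2)%R] =
        (fun z : T * T => h z.1 - h z.2)%R @^-1` `]0%R, +oo[%classic.
      by apply/seteqP; split => z /=; rewrite in_itv /= andbT.
    by rewrite -[X in measurable X]setTI; exact: mh12.
  - rewrite -gradient_flow_descends; congr (Phi _).
    by apply/seteqP; split => z /=; rewrite leNgt => /negP.
  - by move=> x y /=; rewrite !subr_gt0 => /lt_trans h1 /h1; rewrite ltxx.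
have zero w : (forall z, w z = 0)%R -> (\int[K]_z w z = 0)%R.
  by move=> w0; rewrite /Rintegral integral0_eq// => z _; rewrite w0.
split; last by exists [set z : T * T | (0 < h z.1 - h z.2)%R] => //; exact: gradient_flow_no_loops.
split.
- exact: sigma_finiteT.
- split; (rewrite flowE; last by first [exact: mX1|exact: mX2]).
    rewrite (eq_Rintegral _ (g := fun z => \1_A z.1 * u z)%R); last first.
      by move=> z _; exact: (congr1 (@^~ z) (setX1 A)).
    rewrite (gradient_outflow K h01)// -/c mulVf// gt_eqF//.
  rewrite zero ?mulr0// => z; rewrite (congr1 (@^~ z) (setX2 A)) /= indicE.
  have [/set_mem Az|] := boolP (z.2 \in A); last by rewrite mul0r.
  by rewrite /u (hA Az) max_r ?mulr0// subr_le0; case/andP: (h01 z.1).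
- split; (rewrite flowE; last by first [exact: mX1|exact: mX2]).
    rewrite (eq_Rintegral _ (g := fun z => \1_B z.2 * u z)%R); last first.
      by move=> z _; exact: (congr1 (@^~ z) (setX2 B)).
    by rewrite (gradient_inflow kfin rev edge mA mB AB0)// -/c mulVf// gt_eqF.
  rewrite zero ?mulr0// => z; rewrite (congr1 (@^~ z) (setX1 B)) /= indicE.
  have [/set_mem Bz|] := boolP (z.1 \in B); last by rewrite mul0r.
  by rewrite /u (hB Bz) max_r ?mulr0// sub0r oppr_le0; case/andP: (h01 z.2).
- move=> D mD DC; rewrite flowE; last by first [exact: mX1|exact: mX2].
  rewrite flowE; last by first [exact: mX1|exact: mX2].
  congr ((_ * _)%R%:E).
  rewrite (eq_Rintegral _ (g := fun z => \1_D z.2 * u z)%R); last first.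
    by move=> z _; exact: (congr1 (@^~ z) (setX2 D)).
  rewrite [RHS](eq_Rintegral _ (g := fun z => \1_D z.1 * u z)%R); last first.
    by move=> z _; exact: (congr1 (@^~ z) (setX1 D)).
  by rewrite (gradient_balance kfin rev edge mh h01 harm mD DC).
- by exists [set z : T * T | (0 < h z.1 - h z.2)%R].
Qed.

(** Two integrable densities of the same measure agree almost everywhere. *)
Lemma gradient_flow_density : exists N, [/\ measurable N, K N = 0 &
  forall z, ~ N z -> flow_density Phi K z = (u z / c)%:E].
Proof.
have PhiK := gradient_flow_dominated.
have : ae_eq K setT (flow_density Phi K) (fun z => (u z / c)%:E).
  apply: integral_ae_eq => //.
  - exact: Radon_Nikodym_integrable.
  - by apply/measurable_EFinP; case: buc.
  - by move=> E _ mE; rewrite -PhiE// -Radon_Nikodym_integral.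
move=> [N [mN N0 NP]]; exists N; split => // z nNz.
by apply: contrapT => neq; apply: nNz; apply: NP => /= /(_ Logic.I).
Qed.

End gradient_flow.

(** * The potential of the jump process *)

Section hitting_event.
Context (R : realType) d (T : measurableType d) dW (W : measurableType dW).
Variables (Z : nat -> W -> T) (S : nat -> W -> \bar R).
Hypothesis S0 : forall n w, 0 <= S n w.

Lemma jump_time_ge0 n w : 0 <= jump_time S n w.
Proof. by apply: sume_ge0. Qed.

Lemma jump_timeS n w : jump_time S n.+1 w = jump_time S n w + S n w.
Proof. by rewrite /jump_time big_ord_recr. Qed.

Lemma jump_time_le m n w : (m <= n)%N -> jump_time S m w <= jump_time S n w.
Proof.
elim: n => [|n ih]; first by rewrite leqn0 => /eqP ->.
rewrite leq_eqVlt => /predU1P[->//|mn].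
by rewrite jump_timeS (le_trans (ih mn))// leeDl.
Qed.

Lemma jump_index_unique m n w (t : \bar R) :
    jump_time S m w <= t < jump_time S m.+1 w ->
    jump_time S n w <= t < jump_time S n.+1 w -> m = n.
Proof.
move=> /andP[tm tm1] /andP[tn tn1]; apply/eqP; rewrite eqn_leq.
apply/andP; split; rewrite leqNgt; apply/negP => lt.
- by have := lt_le_trans tn1 (jump_time_le w lt); rewrite ltNge tm.
- by have := lt_le_trans tm1 (jump_time_le w lt); rewrite ltNge tn.
Qed.

Local Notation X := (minimal_process Z S).

Lemma minimal_process_on_jump (n : nat) (t : R) w :
    jump_time S n w <= t%:E < jump_time S n.+1 w ->
  X t w = Some (Z n w).
Proof.
move=> nt; rewrite /minimal_process; case: pselect => [e|]; last by case; exists n.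
by congr (Some (Z _ w)); case: (cid e) => /= m mt; exact: jump_index_unique mt nt.
Qed.

Lemma minimal_process_Some (t : R) w x : X t w = Some x ->
  exists2 n, jump_time S n w <= t%:E < jump_time S n.+1 w & Z n w = x.
Proof.
rewrite /minimal_process; case: pselect => // e [<-].
by case: (cid e) => /= n nt; exists n.
Qed.

(** The n-th state lies in C and is occupied by the minimal process during a
    nonempty time interval that begins before explosion. *)
Definition visits (C : set T) (n : nat) : set W :=
  [set w | [/\ C (Z n w), 0 < S n w & jump_time S n w < +oo]].

(** Hitting times are infima over t > 0, and the process sits in its n-th state
    at times arbitrarily close to, but larger than, its n-th jump time. *)
Lemma hitting_time_le C n w : visits C n w ->
  hitting_time X C w <= jump_time S n w.
Proof.
move=> [CZ Spos Tfin]; rewrite leNgt; apply/negP => lt.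
have Tfinn : jump_time S n w \is a fin_num.
  by rewrite ge0_fin_numE// jump_time_ge0.
have TS : jump_time S n w < jump_time S n.+1 w by rewrite jump_timeS lteDl.
pose m := mine (hitting_time X C w) (jump_time S n.+1 w).
have [t Tt tm] : exists2 t : R, jump_time S n w < t%:E & t%:E < m.
  have : jump_time S n w < m by rewrite lt_min lt TS.
  move: Tfinn; case: (jump_time S n w) => // r _; case: m => [s| |] //.
    rewrite lte_fin => rs; exists ((r + s) / 2)%R; rewrite lte_fin; lra.
  by move=> _; exists (r + 1)%R; rewrite ?ltry// lte_fin; lra.
have : hitting_time X C w <= t%:E.
  apply: ereal_inf_lbound; exists t => //; split.
    by rewrite -lte_fin (le_lt_trans _ Tt)// jump_time_ge0.
  exists (Z n w) => //; apply: minimal_process_on_jump.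
  by rewrite (ltW Tt)/=; move: tm; rewrite lt_min => /andP[].
by move: tm; rewrite lt_min => /andP[/lt_geF ->].
Qed.

Lemma hit_visits C t w x : C x -> X t w = Some x ->
  exists n, [/\ visits C n w, jump_time S n w <= t%:E & t%:E < jump_time S n.+1 w].
Proof.
move=> Cx /minimal_process_Some[n /andP[nt tn] Zx]; exists n; split => //.
have Tfin : jump_time S n w < +oo by rewrite (le_lt_trans nt)// ltry.
split => //; first by rewrite Zx.
have := le_lt_trans nt tn; rewrite jump_timeS lteDl//.
by rewrite ge0_fin_numE// jump_time_ge0.
Qed.

(** An identity of events, without exceptional set.  It is what makes the left
    side measurable, so that it has a probability in the usual sense. *)
Lemma hitting_before A B : A `&` B = set0 ->
  [set w | hitting_time X A w < hitting_time X B w] =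
  \bigcup_n (visits A n `&` \bigcap_(j < n) ~` visits B j).
Proof.
move=> AB0; apply/seteqP; split => w /=.
  move=> /ereal_inf_lt[_ [t [t0 [x Ax Xx]] <-] tB].
  have [n [vA nt tn]] := hit_visits Ax Xx; exists n => //; split => // j /= jn vB.
  have := le_trans (hitting_time_le vB) (le_trans (jump_time_le w (ltnW jn)) nt).
  by rewrite leNgt tB.
move=> [n _ [vA nB]]; have [AZ Spos Tfin] := vA.
apply: (le_lt_trans (hitting_time_le vA)).
apply: (@lt_le_trans _ _ (jump_time S n.+1 w)).
  by rewrite jump_timeS lteDl// ge0_fin_numE// jump_time_ge0.
apply: le_ereal_inf_tmp => _ [t [t0 [x Bx Xx]] <-].
have [j [vB jt tj]] := hit_visits Bx Xx.
apply: le_trans jt; apply: jump_time_le; rewrite ltnNge leq_eqVlt.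
apply/negP => /orP[/eqP jn|jn]; last by have := nB j jn.
have : (A `&` B) (Z n w) by split => //; rewrite -jn; case: vB.
by rewrite AB0.
Qed.

End hitting_event.

Section jump_kernel.
Context (R : realType) d (T : measurableType d) (k : R.-ker T ~> T).
Hypothesis kfin : forall x, k x setT < +oo.

Let kfinn x : k x setT \is a fin_num. Proof. by rewrite ge0_fin_numE. Qed.

(** The law of the next state as a measure.  In an absorbing state the
    normalisation falls back on the Dirac mass, as jump_law does. *)
Definition jump_kernel (x : T) : {measure set T -> \bar R} :=
  mnormalize (k x) \d_x.

Lemma jump_kernelE x C : jump_kernel x C = jump_law k x C.
Proof.
rewrite /jump_kernel /= /mnormalize /jump_law.
have [k0|k0] /= := eqVneq (k x setT) 0; first by [].
rewrite (lt_eqF (kfin x)); congr (_ * _).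
rewrite -[in RHS](fineK (kfinn x)) /inve /= ifF//.
by apply/negbTE; rewrite fine_eq0.
Qed.

Lemma measurable_jump_kernel U : measurable U ->
  measurable_fun [set: T] (jump_kernel ^~ U).
Proof.
move=> mU.
rewrite (_ : (fun _ => _) = (fun x =>
    if k x setT == 0 then \d_x U else k x U * ((fine (k x setT)) `^ (-1))%:E)).
  apply: measurable_fun_if => //; first exact: kernel_measurable_fun_eq_cst.
    by apply: measurable_funTS; exact: measurable_fun_dirac.
  apply: measurable_funTS; apply: emeasurable_funM; first exact: measurable_kernel.
  apply/measurable_EFinP; apply: (measurableT_comp (measurable_powR _)).
  by apply: measurableT_comp => //; exact: measurable_kernel.
apply/funext => x; rewrite /jump_kernel /= /mnormalize (lt_eqF (kfin x)) orbF.
by case: ifPn => // _; rewrite powR_inv1// fine_ge0.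
Qed.

Let jump_kernel_setT x : jump_kernel x setT = 1.
Proof. exact: (@probability_setT _ _ _ (mnormalize (k x) \d_x)). Qed.

Lemma jump_kernel_exists : exists p : R.-pker T ~> T, forall x, p x = jump_kernel x.
Proof.
pose H1 := isKernel.Build _ _ _ _ R jump_kernel measurable_jump_kernel.
pose K1 := HB.pack_for (R.-ker T ~> T) jump_kernel H1.
pose H2 := Kernel_isProbability.Build _ _ _ _ R K1 jump_kernel_setT.
by exists (HB.pack_for (R.-pker T ~> T) jump_kernel H1 H2).
Qed.

(** The rate measure is the total rate times the jump law; in an absorbing state
    both sides vanish. *)
Lemma integral_jump_kernel x (g : T -> \bar R) :
    measurable_fun setT g -> (forall y, 0 <= g y) ->
  \int[k x]_y g y = k x setT * \int[jump_kernel x]_y g y.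
Proof.
move=> mg g0; have [k0|k0] := eqVneq (k x setT) 0.
  rewrite k0 mul0e; apply: null_set_integral => //.
have r0 : (0 <= (fine (k x setT))^-1)%R by rewrite invr_ge0 fine_ge0.
rewrite (@eq_measure_integral _ _ _ _ (mscale (NngNum r0) (k x)) (jump_kernel x)).
  rewrite ge0_integral_mscale//= muleA.
  suff -> : k x setT * ((fine (k x setT))^-1)%:E = 1 by rewrite mul1e.
  by rewrite -[X in X * _](fineK (kfinn x)) -EFinM mulfV// fine_eq0.
move=> C mC _; rewrite /jump_kernel /= /mnormalize (negbTE k0) (lt_eqF (kfin x)) /=.
by rewrite muleC.
Qed.

End jump_kernel.

Lemma prob_kernel_setC d d' (X : measurableType d) (S : measurableType d')
    (R : realType) (P : R.-pker X ~> S) x U :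
  measurable U -> P x U = 1 -> P x (~` U) = 0.
Proof.
move=> mU PU; have := @prob_kernel _ _ _ _ _ P x.
rewrite -(setUv U) measureU//; [|exact: measurableC|by rewrite setICr].
rewrite [X in X + _ = _]PU => /(congr1 (fun y => y - 1)).
by rewrite addeAC subee// add0e.
Qed.

Section jump_potential.
Context (R : realType) d (T : measurableType d) dW (W : measurableType dW).
Variables (k : R.-ker T ~> T) (P : R.-pker T ~> W).
Variables (Z : nat -> W -> T) (S : nat -> W -> \bar R).
Hypotheses (kfin : forall x, k x setT < +oo) (jah : jump_and_hold k P Z S).
Variables (A B : set T).
Hypotheses (mA : measurable A) (mB : measurable B) (AB0 : A `&` B = set0).

Local Notation X := (minimal_process Z S).
Let mZ n : measurable_fun setT (Z n). Proof. by case: jah. Qed.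
Let mS n : measurable_fun setT (S n). Proof. by case: jah. Qed.
Let S0 n w : 0 <= S n w. Proof. by case: jah. Qed.
Let start x C : measurable C -> P x (Z 0%N @^-1` C) = \d_x C.
Proof. by case: jah => _ _ _ + _; apply. Qed.
Let step x n E t C : jump_history Z S n E -> (0 <= t)%R -> measurable C ->
    P x (E `&` [set w | t%:E < S n w] `&` (Z n.+1 @^-1` C)) =
    \int[P x]_(w in E)
      ((expR (- (jump_rate k (Z n w) * t)))%:E * jump_law k (Z n w) C).
Proof. by case: jah => _ _ _ _ +; apply. Qed.

Let mpre n C : measurable C -> measurable (Z n @^-1` C).
Proof. by move=> mC; rewrite -[X in measurable X]setTI; exact: mZ. Qed.

Lemma jump_law_setT x : jump_law k x setT = 1.
Proof. by rewrite -jump_kernelE// [LHS]probability_setT. Qed.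

Lemma jump_historyI n E F :
  jump_history Z S n E -> jump_history Z S n F -> jump_history Z S n (E `&` F).
Proof. exact: (@measurableI _ (g_sigma_algebraType _)). Qed.

Lemma jump_history_setT n : jump_history Z S n setT.
Proof. exact: (@measurableT _ (g_sigma_algebraType _)). Qed.

Lemma jump_historyS n E : jump_history Z S n E -> jump_history Z S n.+1 E.
Proof.
apply: sub_sigma_algebra2 => _ [[i ni [C mC ->]]|[i ni [C mC ->]]].
  by left; exists i; [exact: leqW|exists C].
by right; exists i; [exact: leqW|exists C].
Qed.

Lemma jump_history_preimage n C : measurable C -> jump_history Z S n (Z n @^-1` C).
Proof. by move=> mC; apply: sub_sigma_algebra; left; exists n => //; exists C. Qed.

Lemma jump_history_measurable n E : jump_history Z S n E -> measurable E.
Proof.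
apply: smallest_sub; first exact: sigma_algebra_measurable.
move=> _ [[i _ [C mC ->]]|[i _ [C mC ->]]]; rewrite -[X in measurable X]setTI.
  exact: mZ.
exact: mS.
Qed.

Let mSpos n (t : R) : measurable [set w | t%:E < S n w].
Proof.
have -> : [set w | t%:E < S n w] = S n @^-1` `]t%:E, +oo]%classic.
  by apply/seteqP; split => w /=; rewrite in_itv /= ?leey ?andbT.
by rewrite -[X in measurable X]setTI; apply: mS => //; exact: emeasurable_itv.
Qed.

Let jump_step0 x n E C : jump_history Z S n E -> measurable C ->
  P x (E `&` [set w | 0 < S n w] `&` (Z n.+1 @^-1` C)) =
  \int[P x]_(w in E) jump_law k (Z n w) C.
Proof.
move=> hE mC; have := step x hE (lexx 0%R) mC; rewrite -[0%R%:E]/(0%E) => ->.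
by apply: eq_integral => w _; rewrite mulr0 oppr0 expR0 mul1e.
Qed.

Lemma hold_pos_ae x n : P x [set w | S n w <= 0] = 0.
Proof.
have -> : [set w | S n w <= 0] = ~` [set w | 0 < S n w].
  by apply/seteqP; split => w /=; rewrite ltNge; [move=> ->|move=> /negP/negPn].
apply: prob_kernel_setC; first exact: (mSpos n 0%R).
have := jump_step0 x (@jump_history_setT n) measurableT.
rewrite setTI preimage_setT setIT => ->.
under eq_integral do rewrite jump_law_setT.
by rewrite integral_cst// mul1e prob_kernel.
Qed.

Lemma jump_step x n E C : jump_history Z S n E -> measurable C ->
  P x (E `&` (Z n.+1 @^-1` C)) = \int[P x]_(w in E) jump_law k (Z n w) C.
Proof.
move=> hE mC; rewrite -jump_step0//.
have mE := jump_history_measurable hE.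
have mN : measurable [set w | S n w <= 0].
  have -> : [set w | S n w <= 0] = ~` [set w | 0 < S n w].
    by apply/seteqP; split => w /=; rewrite ltNge; [move=> ->|move=> /negP/negPn].
  by apply: measurableC; exact: (mSpos n 0%R).
have mE1 : measurable (E `&` Z n.+1 @^-1` C) by apply: measurableI => //; exact: mpre.
have mE2 : measurable (E `&` [set w | 0 < S n w] `&` Z n.+1 @^-1` C).
  by apply: measurableI; [apply: measurableI => //; exact: (mSpos n 0%R)|exact: mpre].
apply/eqP; rewrite eq_le; apply/andP; split; last first.
  by apply: le_measure; rewrite ?inE// => w [[? _] ?].
rewrite -(measureU0 mE2 mN (hold_pos_ae x n)).
apply: le_measure; rewrite ?inE//; first exact: measurableU.
move=> w [Ew Cw]; have [Sp|Sn] := ltP 0 (S n w); last by right.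
by left.
Qed.

Let rate0 : set T := [set x | k x setT = 0].
Let mrate0 : measurable rate0.
Proof.
have -> : rate0 = (fun x => k x setT) @^-1` [set 0] by [].
rewrite -[X in measurable X]setTI.
exact: (measurable_kernel k setT measurableT measurableT).
Qed.

(** Given a state of rate r > 0, the probability that the holding time exceeds m
    is exp(- r m), which tends to 0; dominated convergence integrates this over
    the states. *)
Lemma hold_infinite_ae x n : P x ([set w | S n w = +oo] `\` (Z n @^-1` rate0)) = 0.
Proof.
have mSoo : measurable [set w | S n w = +oo].
  rewrite -[X in measurable X]setTI.
  exact: (mS n measurableT (emeasurable_set1 +oo)).
set E := ~` (Z n @^-1` rate0).
have mE : measurable E by apply: measurableC; exact: mpre.
have hE : jump_history Z S n E.
  exact: (jump_history_preimage (n := n) (measurableC mrate0)).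
pose f m w := (expR (- (jump_rate k (Z n w) * m%:R)))%:E : \bar R.
have rpos w : E w -> (0 < jump_rate k (Z n w))%R.
  move=> nr; rewrite /jump_rate fine_gt0// kfin andbT lt0e measure_ge0 andbT.
  by apply/eqP.
have mf m : measurable_fun setT (f m).
  apply/measurable_EFinP; apply: measurableT_comp => //.
  apply: measurableT_comp => //; apply: measurable_funM => //.
  apply: (@measurableT_comp _ _ _ _ _ _ (fun y => fine (k y setT))) => //.
  by apply: measurableT_comp => //; exact: measurable_kernel.
have le m : P x ([set w | S n w = +oo] `\` (Z n @^-1` rate0)) <=
    \int[P x]_(w in E) f m w.
  have := step x hE (ler0n R m) measurableT; rewrite preimage_setT setIT.
  under eq_integral do rewrite jump_law_setT mule1.
  move=> <-; apply: le_measure; rewrite ?inE.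
  - by apply: measurableD => //; exact: mpre.
  - by apply: measurableI => //; exact: mSpos.
  - by move=> w [Soo nr]; split => //=; rewrite Soo ltry.
have f_cvg : {ae P x, forall w, E w -> f ^~ w @ \oo --> cst 0 w}.
  apply: aeW => w Ew.
  have : (expR (- (jump_rate k (Z n w) * m%:R)))%R @[m --> \oo] --> (0%R : R).
    under eq_fun do rewrite -mulNr expRM_natr.
    apply: cvg_expr; rewrite ger0_norm ?expR_ge0// expR_lt1 oppr_lt0.
    exact: rpos.
  by apply: cvg_EFin; exact: nearW.
have cst1 : (P x).-integrable E (cst 1).
  apply/integrableP; split => //; rewrite (eq_integral (cst 1)); last first.
    by move=> w _; rewrite /= normr1.
  rewrite integral_cst// mul1e; apply: (@le_lt_trans _ _ (P x setT)).
    by apply: le_measure; rewrite ?inE.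
  by rewrite prob_kernel ltry.
have f_le1 : {ae P x, forall w m, E w -> `|f m w| <= cst 1 w}.
  apply: aeW => w m Ew; rewrite gee0_abs ?lee_fin ?expR_ge0// expR_le1 oppr_le0.
  by rewrite mulr_ge0// ltW// rpos.
have [_ _ cvg0] := dominated_convergence mE
  (fun m => measurable_funTS (mf m)) (measurable_cst _) f_cvg cst1 f_le1.
apply/eqP; rewrite eq_le measure_ge0 andbT.
rewrite integral0 in cvg0.
rewrite -(cvg_lim _ cvg0)//; apply: lime_ge; last by apply: nearW => m; exact: le.
by apply/cvg_ex; exists 0.
Qed.

Let rate0_law x C : rate0 x -> jump_law k x C = \d_x C.
Proof. by move=> kx0; rewrite /jump_law kx0 eqxx. Qed.

(** A state of rate 0 is never left.  With A removed from these states, iterating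
    the lemma shows that A is not entered after an absorbing state off A. *)
Lemma absorbing_ae x n :
  P x (Z n @^-1` (rate0 `\` A) `\` Z n.+1 @^-1` (rate0 `\` A)) = 0.
Proof.
have mrA : measurable (rate0 `\` A) by exact: measurableD.
have -> : Z n @^-1` (rate0 `\` A) `\` Z n.+1 @^-1` (rate0 `\` A) =
    Z n @^-1` (rate0 `\` A) `&` Z n.+1 @^-1` (~` (rate0 `\` A)) by [].
rewrite jump_step; [|exact: jump_history_preimage|exact: measurableC].
rewrite integral0_eq// => w [r0 nA]; rewrite rate0_law// diracE memNset//.
by move=> /(_ (conj r0 nA)).
Qed.

Definition before_hit (n : nat) : set W :=
  [set w | forall i, (i < n)%N -> ~ (A `|` B) (Z i w)].

Lemma before_hit0 : before_hit 0 = setT.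
Proof. by apply/seteqP; split. Qed.

Lemma before_hitS n :
  before_hit n.+1 = before_hit n `&` Z n @^-1` (~` (A `|` B)).
Proof.
apply/seteqP; split => w /=.
  by move=> h; split; [move=> i ni; apply: h; exact: ltnW|exact: h].
move=> [h1 h2] i; rewrite ltnS leq_eqVlt => /predU1P[->//|]; exact: h1.
Qed.

Lemma before_hit_history n : jump_history Z S n (before_hit n.+1).
Proof.
have mAB : measurable (~` (A `|` B)) by apply: measurableC; exact: measurableU.
elim: n => [|n ih]; rewrite before_hitS.
  rewrite before_hit0 setTI; exact: jump_history_preimage.
by apply: jump_historyI; [exact: jump_historyS|exact: jump_history_preimage].
Qed.

Let mbefore n : measurable (before_hit n).
Proof.
case: n => [|n]; first by rewrite before_hit0.
exact: jump_history_measurable (@before_hit_history n).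
Qed.

Definition first_hit (n : nat) : set W := before_hit n `&` Z n @^-1` A.

Lemma measurable_first_hit n : measurable (first_hit n).
Proof. by apply: measurableI => //; exact: mpre. Qed.

Let mvisits C n : measurable C -> measurable (visits Z S C n).
Proof.
move=> mC.
have -> : visits Z S C n = Z n @^-1` C `&` ([set w | 0 < S n w] `&`
    [set w | jump_time S n w < +oo]).
  by apply/seteqP; split => w /= => [[? ? ?]|[? [? ?]]].
apply: measurableI; first exact: mpre.
apply: measurableI; first exact: (mSpos n 0%R).
have mT : measurable_fun setT (jump_time S n) by exact: emeasurable_sum.
by rewrite -[X in measurable X]setTI; exact: measurable_lte.
Qed.

(** Off a null set all holding times are positive, and an infinite holding time
    means that the chain is stuck.  Then a chain that enters A does so at a
    finite time, the process sees every state visited up to then, and entering A before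
    B in continuous time means that the first state of the chain in A or B lies
    in A. *)
Lemma hitting_before_first_hit x :
  P x [set w | hitting_time X A w < hitting_time X B w] =
  P x (\bigcup_n first_hit n).
Proof.
rewrite (hitting_before Z S0 AB0).
(* the paths that violate one of the three almost sure properties at step n *)
pose N n := [set w | S n w <= 0] `|` ([set w | S n w = +oo] `\` (Z n @^-1` rate0))
  `|` (Z n @^-1` (rate0 `\` A) `\` Z n.+1 @^-1` (rate0 `\` A)).
have mSle n : measurable [set w | S n w <= 0].
  by rewrite -[X in measurable X]setTI; exact: measurable_lee.
have mSoo n : measurable ([set w | S n w = +oo] `\` (Z n @^-1` rate0)).
  apply: measurableD; last exact: mpre.
  by rewrite -[X in measurable X]setTI; exact: (mS n measurableT (emeasurable_set1 +oo)).
have mabs n : measurable (Z n @^-1` (rate0 `\` A) `\` Z n.+1 @^-1` (rate0 `\` A)).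
  by apply: measurableD; apply: mpre; exact: measurableD.
have mN n : measurable (N n) by apply: measurableU => //; exact: measurableU.
have mcupN : measurable (\bigcup_n N n) by exact: bigcupT_measurable.
have N0 : P x (\bigcup_n N n) = 0.
  apply/eqP; rewrite eq_le measure_ge0 andbT.
  apply: (le_trans (measure_sigma_subadditive (P x) mN mcupN (@subset_refl _ _))).
  rewrite eseries0// => n _ _ /=; rewrite measureU0 ?absorbing_ae//; last exact: measurableU.
  by rewrite measureU0// ?hold_infinite_ae// hold_pos_ae.
have mev : measurable (\bigcup_n (visits Z S A n `&` \bigcap_(j < n) ~` visits Z S B j)).
  apply: bigcupT_measurable => n; apply: measurableI; first exact: mvisits.
  by apply: bigcap_measurableType => j _; apply: measurableC; exact: mvisits.
have mcup : measurable (\bigcup_n first_hit n).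
  by apply: bigcupT_measurable => n; exact: measurable_first_hit.
rewrite -(measureU0 mev mcupN N0) -[RHS](measureU0 mcup mcupN N0); congr (P x _).
apply/seteqP; split => w [|Nw]; try by right.
all: have [Nw|nN] := pselect ((\bigcup_n N n) w); first by right.
all: have Spos i : 0 < S i w by
  rewrite ltNge; apply/negP => Si; apply: nN; exists i => //; left; left.
- move=> [n _ [[An _ Tfin] nB]]; left.
  have ex : exists m, `[< (A `|` B) (Z m w) >] by exists n; apply/asboolP; left.
  have [m /asboolP ABm mmin] := ex_minnP ex.
  have mn : (m <= n)%N by apply: mmin; apply/asboolP; left.
  exists m => //; split.
    by move=> i im ABi; have := mmin i (asboolT ABi); rewrite leqNgt im.
  case: ABm => // Bm; exfalso.
  have [mEn|mLn] : m = n \/ (m < n)%N.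
    by move: mn; rewrite leq_eqVlt => /predU1P.
  + have : (A `&` B) (Z n w) by split => //; rewrite -mEn.
    by rewrite AB0.
  + apply: (nB m mLn); split => //.
    exact: le_lt_trans (jump_time_le S0 w mn) Tfin.
- move=> [n _ [pre An]]; left; exists n => //; split; last first.
    by move=> j /= jn [Bj _ _]; apply: (pre j) => //; right.
  split => //.
  have Sfin i : (i < n)%N -> S i w < +oo.
    move=> lt_in; rewrite ltey; apply/eqP => Soo.
    (* an absorbing state off A would keep the chain off A for ever, but the
       n-th state is in A *)
    have stuck j : (rate0 `\` A) (Z (i + j)%N w).
      elim: j => [|j ih].
        rewrite addn0; split.
          by apply: contrapT => nr; apply: nN; exists i => //; left; right.
        by move=> Ai; apply: (pre i lt_in); left.
      rewrite addnS; apply: contrapT => nr.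
      by apply: nN; exists (i + j)%N => //; right.
    by case: (stuck (n - i)%N); rewrite subnKC// ltnW.
  have Tfin i : (i <= n)%N -> jump_time S i w < +oo.
    elim: i => [|i ih] lt_in; first by rewrite /jump_time big_ord0 ltry.
    by rewrite jump_timeS lte_add_pinfty ?Sfin// ih// ltnW.
  exact: Tfin.
Qed.

(** The probability that the jump chain started at x enters A at step n without
    having met A or B before, written as the recursion given by the first step. *)
Fixpoint reach (n : nat) (x : T) : \bar R :=
  if n is n'.+1 then
    (\1_(~` (A `|` B)) x)%:E * \int[jump_kernel k x]_y reach n' y
  else (\1_A x)%:E.

Let mAB : measurable (~` (A `|` B)).
Proof. by apply: measurableC; exact: measurableU. Qed.

Lemma reach_ge0 n x : 0 <= reach n x.
Proof.
elim: n x => [|n ih] x /=; first by rewrite lee_fin.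
by rewrite mule_ge0 ?lee_fin// integral_ge0.
Qed.

Lemma measurable_reach n : measurable_fun setT (reach n).
Proof.
elim: n => [|n ih] /=; first exact/measurable_EFinP/measurable_indic.
apply: emeasurable_funM; first exact/measurable_EFinP/measurable_indic.
apply: measurable_fun_integral_kernel => //; last exact: reach_ge0.
exact: measurable_jump_kernel.
Qed.

(** The Markov property, moving one factor at a time from the path into the
    recursion. *)
Lemma reach_before_hit x m n :
  \int[P x]_(w in before_hit m) reach n (Z m w) = reach (m + n) x.
Proof.
have [p pE] := jump_kernel_exists kfin.
elim: m n => [|m ih] n.
  rewrite before_hit0 -(integral_image_restr (M := \d_x) (mZ 0%N) measurableT).
  - by rewrite integral_dirac ?diracT ?mul1e//; exact: measurable_reach.
  - by move=> C mC; rewrite setTI start.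
  - exact: measurable_reach.
  - exact: reach_ge0.
rewrite addSnnS -ih before_hitS.
have mE : measurable (before_hit m `&` Z m @^-1` (~` (A `|` B))).
  by rewrite -before_hitS.
rewrite (markov_step_integral (l := p) (Y0 := Z m))//; last 3 first.
- move=> C mC; rewrite -before_hitS jump_step//; last exact: before_hit_history.
  by apply: eq_integral => w _; rewrite pE jump_kernelE.
- exact: measurable_reach.
- exact: reach_ge0.
rewrite integral_mkcondr; apply: eq_integral => w _ /=.
rewrite patchE indicE pE; case: ifPn => h.
  by rewrite mem_set ?mul1e//; exact: (set_mem h).
by rewrite memNset ?mul0e//; move: h; rewrite notin_setE.
Qed.

Lemma first_hit_reach x n : P x (first_hit n) = reach n x.
Proof.
rewrite -[n in RHS]addn0 -reach_before_hit /=.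
transitivity (\int[P x]_(w in before_hit n) (\1_(Z n @^-1` A) w)%:E).
  by rewrite integral_indic 1?setIC//; exact: mpre.
by [].
Qed.

Definition hit_prob x : \bar R := \sum_(n <oo) reach n x.

Lemma hitting_before_prob x :
  P x [set w | hitting_time X A w < hitting_time X B w] = hit_prob x.
Proof.
rewrite hitting_before_first_hit.
rewrite measure_bigcup//=; last 2 first.
- by move=> n _; exact: measurable_first_hit.
- move=> i j _ _ [w [[prei Ai] [prej Aj]]].
  case: (ltngtP i j) => // ij; exfalso.
    by apply: (prej i ij); left.
  by apply: (prei j ij); left.
rewrite eseries_mkcond; apply: eq_eseriesr => n _.
by rewrite mem_set//; exact: first_hit_reach.
Qed.

Lemma hit_prob_A x : A x -> hit_prob x = 1.
Proof.
move=> Ax; rewrite /hit_prob nneseries_recl//; last by move=> n _; exact: reach_ge0.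
rewrite [X in X + _]/= indicE mem_set// eseries0 ?adde0// => -[//|n] _ _ /=.
by rewrite indicE memNset ?mul0e//; apply; left.
Qed.

Lemma hit_prob_B x : B x -> hit_prob x = 0.
Proof.
move=> Bx; rewrite /hit_prob eseries0// => -[|n] _ _ /=.
  rewrite indicE memNset// => Ax; have : (A `&` B) x by [].
  by rewrite AB0.
by rewrite indicE memNset ?mul0e//; apply; right.
Qed.

(** Off A and B the recursion shifts the series by one. *)
Lemma hit_prob_harmonic x : ~ A x -> ~ B x ->
  \int[jump_kernel k x]_y hit_prob y = hit_prob x.
Proof.
move=> nA nB; rewrite /hit_prob integral_nneseries//; last 2 first.
- by move=> n; exact: measurable_reach.
- by move=> n y _; exact: reach_ge0.
rewrite [RHS]nneseries_recl//; last by move=> n _; exact: reach_ge0.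
rewrite [X in X + _]/= indicE memNset// add0e.
rewrite -(nneseries_addn 1); last by move=> n; exact: reach_ge0.
apply: eq_eseriesr => n _; rewrite addn1 /= indicE mem_set ?mul1e//.
by move=> [].
Qed.

End jump_potential.

(** * Capacity and the variational principle *)

Section capacity_as_outflow.
Context (R : realType) d (T : measurableType d) dW (W : measurableType dW).
Variables (mu : {measure set T -> \bar R}) (k : R.-ker T ~> T) (P : R.-pker T ~> W).
Variables (K : {finite_measure set (T * T)%type -> \bar R}).
Variables (Z : nat -> W -> T) (S : nat -> W -> \bar R).
Hypotheses (kfin : forall x, k x setT < +oo) (jah : jump_and_hold k P Z S).
Hypothesis edge : edge_measure mu k K.
Variables (A B : set T).
Hypotheses (mA : measurable A) (mB : measurable B) (AB0 : A `&` B = set0).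

Local Notation X := (minimal_process Z S).
Local Notation h := (Defs.harmonic P X A B).
Local Notation p := (hit_prob k A B).

Let p_ge0 x : 0 <= p x.
Proof. by apply: nneseries_ge0 => n _ _; exact: reach_ge0. Qed.

Let p_le1 x : p x <= 1.
Proof.
rewrite -(hitting_before_prob kfin jah mA mB AB0) (hitting_before_first_hit kfin jah mA mB AB0).
rewrite -(@prob_kernel _ _ _ _ _ P x); apply: le_measure; rewrite ?inE//.
by apply: bigcupT_measurable => n; exact: (measurable_first_hit jah).
Qed.

Let p_fin x : p x \is a fin_num.
Proof. by rewrite ge0_fin_numE// (le_lt_trans (p_le1 x)) ?ltry. Qed.

Lemma harmonicE x : h x = fine (p x).
Proof.
rewrite /Defs.harmonic; case: ifPn => [/set_mem Ax|_].
  by rewrite (hit_prob_A k B Ax).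
case: ifPn => [/set_mem Bx|_]; first by rewrite (hit_prob_B k AB0 Bx).
by rewrite (hitting_before_prob kfin jah mA mB AB0).
Qed.

Let measurable_p : measurable_fun setT p.
Proof.
apply: ge0_emeasurable_sum => [n x _ _|n _]; first exact: reach_ge0.
exact: measurable_reach.
Qed.

Lemma measurable_harmonic : measurable_fun setT h.
Proof.
rewrite (_ : h = fine \o p); first exact: measurableT_comp.
by apply/funext => x; exact: harmonicE.
Qed.

Lemma harmonic01 x : (0 <= h x <= 1)%R.
Proof.
rewrite harmonicE fine_ge0//= -[1%R]/(fine 1); apply: fine_le => //.
Qed.

Lemma harmonic_A x : A x -> h x = 1%R.
Proof. by move=> Ax; rewrite /Defs.harmonic mem_set. Qed.

Lemma harmonic_B x : B x -> h x = 0%R.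
Proof.
move=> Bx; rewrite /Defs.harmonic memNset ?mem_set// => Ax.
by have : (A `&` B) x by []; rewrite AB0.
Qed.

Lemma harmonic_mean x : ~ A x -> ~ B x ->
  \int[k x]_y (h y)%:E = (h x)%:E * k x setT.
Proof.
move=> nA nB; under eq_integral do rewrite harmonicE fineK//.
rewrite integral_jump_kernel// hit_prob_harmonic// harmonicE fineK//.
by rewrite muleC.
Qed.

Lemma capacity_outflow : capacity mu k P X A B = (outflow K A h)%:E.
Proof.
have mh := measurable_harmonic.
have bh : bounded_measurable h.
  by split => //; exists 1%R => x; case/andP: (harmonic01 x) => ? ?; rewrite ger0_norm.
have m1h : measurable_fun setT (fun y => 1 - h y)%R by exact: measurable_funB.
have h_le1 y : (0 <= 1 - h y)%R by case/andP: (harmonic01 y) => _; rewrite subr_ge0.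
rewrite -bRintegralE; last by bounded_measurability.
rewrite (integral_edge kfin edge); last 2 first.
- apply/measurable_EFinP; apply: measurable_funM.
    by apply: measurableT_comp => //; exact: measurable_indic.
  exact: (measurableT_comp m1h).
- by move=> z; rewrite lee_fin mulr_ge0.
rewrite /capacity integral_mkcond; apply: eq_integral => x _.
rewrite patchE; case: ifPn => xA; last first.
  by rewrite integral0_eq// => y _ /=; rewrite indicE (negbTE xA) mul0r.
rewrite /generator (harmonic_A (set_mem xA)).
under [RHS]eq_integral do rewrite /= indicE xA mul1r.
rewrite (eq_integral (fun y => - (1 - h y)%:E)); last first.
  by move=> y _; rewrite -EFinN opprB.
by rewrite integral_ge0N ?oppeK// => y _; rewrite lee_fin.
Qed.

End capacity_as_outflow.

Theorem theorem1p4 (R : realType) (Omega : completePseudoMetricType R)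
  (hOmega : polish Omega)
  (k : R.-ker borel Omega ~> borel Omega)
  (hk : forall x, k x setT < +oo)
  (mu : {sigma_finite_measure set (borel Omega) -> \bar R})
  (hrev : reversible mu k)
  (K : {finite_measure set (borel Omega * borel Omega)%type -> \bar R})
  (hK : edge_measure mu k K)
  (hpos : {ae mu, forall x, 0 < k x setT})
  (dW : measure_display) (W : measurableType dW)
  (P : R.-pker borel Omega ~> W)
  (Z : nat -> W -> borel Omega) (S : nat -> W -> \bar R)
  (hX : jump_and_hold k P Z S)
  (hirr : irreducible mu P (minimal_process Z S))
  (hrec : recurrent mu P (minimal_process Z S))
  (A B : set (borel Omega)) (mA : measurable A) (mB : measurable B)
  (hAB : A `&` B = set0)
  (dV : measure_display) (V : measurableType dV)
  (Q : {finite_measure set (borel Omega * borel Omega)%type -> \bar R} ->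
       probability V R)
  (Y : nat -> V -> borel Omega)
  (hY : forall Phi, ac_flows A B K Phi -> flow_chain A Phi (Q Phi) Y) :
  capacity mu k P (minimal_process Z S) A B =
    sup_ge0 [set flow_value Phi K (Q Phi) Y B | Phi in ac_flows A B K]
  /\
  capacity mu k P (minimal_process Z S) A B =
    sup_ge0 [set flow_value Phi K (Q Phi) Y B | Phi in ac_loop_free_flows A B K].
Proof.
rewrite (capacity_outflow hk hX hK mA mB hAB).
set h := Defs.harmonic P (minimal_process Z S) A B.
have mh : measurable_fun setT h := measurable_harmonic hk hX mA mB hAB.
have h01 : forall x, (0 <= h x <= 1)%R := harmonic01 hk hX mA mB hAB.
have hA : forall x, A x -> h x = 1%R by exact: harmonic_A.
have hB : forall x, B x -> h x = 0%R by move=> x; exact: harmonic_B.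
have harm : forall x, ~ A x -> ~ B x ->
    \int[k x]_y (h y)%:E = (h x)%:E * k x setT := harmonic_mean hk hX mA mB hAB.
have c0 : (0 <= outflow K A h)%R by exact: (outflow_ge0 K A h01).
have upper Phi : ac_flows A B K Phi ->
    flow_value Phi K (Q Phi) Y B <= (outflow K A h)%:E.
  move=> acPhi; have [flow PhiK] := acPhi.
  have [_ _ _ _ [chi [mchi chi0 anti]]] := flow.
  have := flow_value_le_energy mA mB flow (hY _ acPhi) PhiK mh hA hB mchi chi0.
  move=> /le_trans; apply.
  exact: (antisymmetric_energy_le hk hrev hK mA mh h01 hA hB harm mchi anti).
have lower : (0 < outflow K A h)%R -> exists Phi, ac_loop_free_flows A B K Phi /\
    flow_value Phi K (Q Phi) Y B = (outflow K A h)%:E.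
  move=> cpos.
  have [Phi PhiE] := gradient_flow_exists mh h01 cpos.
  have PhiK := gradient_flow_dominated mh h01 PhiE.
  have free := gradient_flow_loop_free hk hrev hK mA mB hAB mh h01 hA hB harm cpos PhiE.
  exists Phi; split; first by split.
  have acPhi : ac_flows A B K Phi by split => //; case: free.
  have [N [mN KN density]] := gradient_flow_density mh h01 PhiE.
  exact: (flow_value_gradient mA mB (proj1 free) (hY _ acPhi) PhiK mh hA hB cpos mN KN
    density (gradient_flow_descends mh PhiE)).
have sub Phi : ac_loop_free_flows A B K Phi -> ac_flows A B K Phi.
  by move=> [[flow _] PhiK]; split.
have sup_eq (F : set {finite_measure set (borel Omega * borel Omega)%type -> \bar R}) :
    ac_loop_free_flows A B K `<=` F -> F `<=` ac_flows A B K ->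
    (outflow K A h)%:E = sup_ge0 [set flow_value Phi K (Q Phi) Y B | Phi in F].
  move=> freeF Fac; apply/eqP; rewrite eq_le; apply/andP; split.
    have [/lower[Phi [free <-]]|c_le0] := ltP 0%R (outflow K A h).
      by apply: ereal_sup_ubound; right; exists Phi => //; exact: freeF.
    have -> : outflow K A h = 0%R by apply/eqP; rewrite eq_le c_le0 c0.
    by apply: ereal_sup_ubound; left.
  apply: ge_ereal_sup => _ [->|[Phi FPhi <-]]; first by rewrite lee_fin.
  by apply: upper; exact: Fac.
by split; apply: sup_eq.
Qed.
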